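(* For any $r\ge 2$, any positive integer $h$, any $\vec{b}=(b_1,b_2)$, and any $\epsilon>0$, there exist an increasing function $m:\mathbb{N}\to\mathbb{N}$ and an integer $\tilde{n}$ (depending only on $r,h,\vec{b},\epsilon$, and independent of $\mathbf{\Omega}$) such that the following holds: if $\mathbf{G}$ is a $\vec{b}$-colored $r$-partite graph on $\mathbf{\Omega}$, then \[ \mathbb{E}_{n}\,\mathbb{E}_{\varphi}\big[\mathbf{reg}_{h}(\mathbf{G}/\varphi)\big]\le \epsilon, \] where $n$ is chosen uniformly at random in $\{0,1,\dots,\tilde{n}-1\}$ and $\varphi\in\Phi(m(n))$ is a random partitionwise map.
   Context: Fix an integer $r$ and an index set $\mathfrak{r}$ with $|\mathfrak{r}|=r$, and for each $i\in\mathfrak{r}$ a finite nonempty probability space $(\mathbf{\Omega}_i,2^{\mathbf{\Omega}_i},\mathbb{P})$; write $\mathbf{\Omega}=(\mathbf{\Omega}_i)_{i\in\mathfrak{r}}$. For disjoint vertex sets $X_i$ ($i\in\mathfrak{r}$) and $J\subset\mathfrak{r}$, let $X_J$ be the set of $Y\subset\bigcup_{i\in J}X_i$ with $|Y\cap X_j|=1$ for all $j\in J$. A $(b_1,b_2)$-colored $\mathfrak{r}$-partite graph $H$ consists of vertex sets $X_i$, and for every $I\subset\mathfrak{r}$ with $|I|\in\{1,2\}$ a color set $C_I(H)$ with at most $b_{|I|}$ elements and a map assigning to each index-$I$ edge $e\in X_I$ a color $H(e)\in C_I(H)$ (index-$\{i\}$ edges are vertices). For $e=\{v_i,v_j\}$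 the frame-color is $H(\partial e)=(H(v_i),H(v_j))$ and the total color is $H\langle e\rangle=(H(e);H(v_i),H(v_j))$; for a vertex, $H\langle v\rangle=H(v)$ and its frame-color is empty. $\mathrm{TC}_I(H)$ is the set of total colors of index-$I$ edges, $\mathrm{TC}_2(H)$ the union over $|I|=2$. A complex is such a colored graph where each index $I$ has at most one ''invisible'' color, and if an edge is invisible then every edge containing it is invisible. For a graph $\mathbf{G}$ on $\mathbf{\Omega}$, $\mathcal{S}_{h,\mathbf{G}}$ is the set of complexes $S$ with exactly $h$ vertices in each of its $r$ parts whose visible index-$I$ colors are (injectively identified with) index-$I$ colors of $\mathbf{G}$; $\mathbb{V}_1(S),\mathbb{V}_2(S)$ are the visible vertices and visible pairs, $\mathbb{V}(S)=\mathbb{V}_1(S)\cup\mathbb{V}_2(S)$. A partitionwise map sends finite sets $W_i$ into $\mathbf{\Omega}_i$; $\Phi(h)$ denotes such maps with $|W_i|=h$; it is random if each $w\in W_i$ is mapped independently according to $\mathbb{P}$ on $\mathbf{\Omega}_i$. Regularization: for $\varphi\in\Phi(m)$, $\mathbf{G}/\varphi$ is obtained from $\mathbf{G}$ by recoloring each vertex $\mathbf{v}\in\mathbf{\Omega}_i$ by the vector $(\mathbf{G}(\{\mathbf{v},\mathbf{u}\}) : \mathbf{u}=\mathbf{v}$, or $\mathbf{u}\in\mathbf{\Omega}_j$, $j\ne i$, in the range of $\varphi)$, where $\mathbf{G}(\{\mathbf{v},\mathbf{v}\})$ means $\mathbf{G}(\mathbf{v})$; pair colors are unchanged. Relative density: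 for $\vec{\mathfrak{c}}=(\mathfrak{c}_J)_{J\subset I}\in\mathrm{TC}_I(\mathbf{G})$, $\mathbf{d}_{\mathbf{G}}(\vec{\mathfrak{c}})=\mathbb{P}_{\mathbf{e}\in\mathbf{\Omega}_I}[\mathbf{G}(\mathbf{e})=\mathfrak{c}_I\mid \mathbf{G}(\partial\mathbf{e})=(\mathfrak{c}_J)_{J\subsetneq I}]$ (no condition when $|I|=1$). $\mathbf{G}$ is $(\epsilon,h)$-regular if there is $\delta:\mathrm{TC}_2(\mathbf{G})\to[0,\infty)$ such that (i) for all $S\in\mathcal{S}_{h,\mathbf{G}}$, $\mathbb{P}_{\phi\in\Phi(h)}[\mathbf{G}(\phi(e))=S(e)\ \forall e\in\mathbb{V}(S)]=\prod_{e\in\mathbb{V}_1(S)}\mathbf{d}_{\mathbf{G}}(S\langle e\rangle)\prod_{e\in\mathbb{V}_2(S)}\big(\mathbf{d}_{\mathbf{G}}(S\langle e\rangle)\dot{\pm}\delta(S\langle e\rangle)\big)$, where $a\dot{\pm}b$ denotes some number in $[\max\{0,a-b\},\min\{1,a+b\}]$; and (ii) $\mathbb{E}_{\mathbf{e}\in\mathbf{\Omega}_I}[\delta(\mathbf{G}\langle\mathbf{e}\rangle)]\le\epsilon/|C_I(\mathbf{G})|$ for all $I\subset\mathfrak{r}$ with $|I|=2$. $\mathbf{reg}_h(\mathbf{G})$ is the minimum $\epsilon$ for which $\mathbf{G}$ is $(\epsilon,h)$-regular. *)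

(* Defs.v *)
From HB Require Import structures.
From mathcomp Require Import all_boot all_order all_algebra.
From mathcomp Require Import boolp classical_sets reals.

Set Implicit Arguments.
Unset Strict Implicit.
Unset Printing Implicit Defensive.

Import Order.TTheory GRing.Theory Num.Theory.

Local Open Scope ring_scope.

(* A probability on (T, 2^T); T is nonempty because the masses sum to 1. *)
Record fdist (R : realType) (T : finType) := FDist {
  pmf :> T -> R;
  pmf_ge0 : forall x, 0 <= pmf x;
  pmf_sum1 : \sum_x pmf x = 1 }.

Definition Pr (R : realType) (T : finType) (p : T -> R) (A : pred T) : R :=
  \sum_(x | A x) p x.

(* Division by zero yields 0: conditioning on a null event gives 0. *)
Definition cPr (R : realType) (T : finType) (p : T -> R) (A B : pred T) : R :=
  Pr p (predI A B) / Pr p B.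

Definition Ex (R : realType) (T : finType) (p : T -> R) (f : T -> R) : R :=
  \sum_x p x * f x.

(* An index-{i,j} edge is given by its endpoints x : X i and y : X j, i != j;
   ecol i j is unconstrained for i = j.  The colour set C_{i} is [vcols i] and
   C_I, for |I| = 2, is [ecols I]; the types vK i and eK are ambient, and eK is
   common to all I so that the symmetry of ecol can be stated without casts. *)
Record cgraph (r : nat) (X : 'I_r -> finType) (vK : 'I_r -> finType)
    (eK : finType) := CGraph {
  vcols : forall i, {set vK i};
  ecols : {set 'I_r} -> {set eK};
  vcol : forall i, X i -> vK i;
  ecol : forall i j, X i -> X j -> eK;
  vcolP : forall i x, @vcol i x \in vcols i;
  ecolP : forall i j x y, i != j -> @ecol i j x y \in ecols [set i; j];
  ecolC : forall i j x y, i != j -> @ecol i j x y = @ecol j i y x }.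

Arguments vcol {r X vK eK} c i x.
Arguments ecol {r X vK eK} c i j x y.

Definition colored_by (r : nat) (X vK : 'I_r -> finType) (eK : finType)
    (b1 b2 : nat) (H : cgraph X vK eK) : Prop :=
  (forall i, #|vcols H i| <= b1)%N /\
  (forall I : {set 'I_r}, #|I| = 2 -> #|ecols H I| <= b2)%N.

Definition pmap (r : nat) (Omega : 'I_r -> finType) (m : nat) : finType :=
  {dffun forall i : 'I_r, {ffun 'I_m -> Omega i}}.

Definition pmap_dist (R : realType) (r : nat) (Omega : 'I_r -> finType)
    (P : forall i, fdist R (Omega i)) (m : nat) (phi : pmap Omega m) : R :=
  \prod_(i < r) \prod_(w < m) P i (phi i w).

Definition edge_dist (R : realType) (r : nat) (Omega : 'I_r -> finType)
    (P : forall i, fdist R (Omega i)) (i j : 'I_r) (e : Omega i * Omega j) : R :=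
  P i e.1 * P j e.2.

Section Regularize.
Variables (r : nat) (Omega vK : 'I_r -> finType) (eK : finType).
Variables (G : cgraph Omega vK eK) (m : nat) (phi : pmap Omega m).

Definition seen (i : 'I_r) : pred {j : 'I_r & Omega j} :=
  fun u => (tag u != i) && (tagged u \in codom (phi (tag u))).

Definition reg_vK (i : 'I_r) : finType :=
  (vK i * {ffun {u | seen i u} -> eK})%type.

Definition reg_vcols (i : 'I_r) : {set reg_vK i} :=
  finset.setX (vcols G i)
    [set f : {ffun {u | seen i u} -> eK} |
      [forall u, f u \in ecols G [set i; tag (val u)]]].

Definition reg_vcol (i : 'I_r) (x : Omega i) : reg_vK i :=
  (vcol G i x,
   [ffun u : {u | seen i u} => ecol G i (tag (val u)) x (tagged (val u))]).

Lemma reg_vcolP (i : 'I_r) (x : Omega i) : reg_vcol x \in reg_vcols i.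
Proof.
rewrite finset.in_setX vcolP inE; apply/forallP => u; rewrite ffunE; apply: ecolP.
by have /andP[] := valP u; rewrite eq_sym.
Qed.

(* The graph G/phi. *)
Definition regularize : cgraph Omega reg_vK eK :=
  CGraph reg_vcolP (@ecolP _ _ _ _ G) (@ecolC _ _ _ _ G).

End Regularize.

Section Regularity.
Variables (R : realType) (r : nat) (Omega vK : 'I_r -> finType) (eK : finType).
Variables (P : forall i, fdist R (Omega i)) (h : nat) (G : cgraph Omega vK eK).

Definition vdens (i : 'I_r) (c : vK i) : R :=
  Pr (P i) (fun x => vcol G i x == c).

Definition edens (i j : 'I_r) (c : eK) (ci : vK i) (cj : vK j) : R :=
  cPr (edge_dist P (i := i) (j := j))
    (fun e => ecol G i j e.1 e.2 == c)
    (fun e => (vcol G i e.1 == ci) && (vcol G j e.2 == cj)).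

(* The colour None is the invisible one, and a visible colour of S is
   identified with the colour of G that corresponds to it. *)
Definition scomplex : Type :=
  cgraph (fun _ : 'I_r => 'I_h) (fun i => option (vK i)) (option eK).

Definition is_complex (S : scomplex) : Prop :=
  [/\ forall i, vcols S i \subset None |: [set Some c | c in vcols G i],
      forall I : {set 'I_r}, #|I| = 2%N ->
        ecols S I \subset None |: [set Some c | c in ecols G I]
    & forall i j (a b : 'I_h), i != j ->
        vcol S i a = None -> ecol S i j a b = None].

Definition embeds (S : scomplex) (phi : pmap Omega h) : bool :=
  [forall i : 'I_r, forall a : 'I_h,
     (vcol S i a != None) ==>
     (vcol S i a == Some (vcol G i (phi i a)))] &&
  [forall i : 'I_r, forall j : 'I_r, forall a : 'I_h, forall b : 'I_h,
     ((i < j)%N && (ecol S i j a b != None)) ==>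
     (ecol S i j a b == Some (ecol G i j (phi i a) (phi j b)))].

(* t is a possible value of a \dot{\pm} b. *)
Definition dotpm (a b t : R) : bool :=
  Num.max 0 (a - b) <= t <= Num.min 1 (a + b).

(* Unordered pairs of parts are enumerated as i < j.  delta is a total function
   of (index, total colour); its values outside TC_2(G) are irrelevant, as there
   edens vanishes and so does the left-hand side of the counting identity. *)
Definition regular (eps : R) : Prop :=
  exists delta : forall i j : 'I_r, eK -> vK i -> vK j -> R,
  [/\ forall i j c ci cj, 0 <= delta i j c ci cj,
      forall S : scomplex, is_complex S ->
        exists t : 'I_r -> 'I_r -> 'I_h -> 'I_h -> R,
          (forall (i j : 'I_r) (a b : 'I_h) c ci cj, (i < j)%N ->
             ecol S i j a b = Some c ->
             vcol S i a = Some ci ->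
             vcol S j b = Some cj ->
             dotpm (edens c ci cj) (delta i j c ci cj) (t i j a b)) /\
          Pr (pmap_dist P (m := h)) (embeds S) =
            (\prod_(i < r) \prod_(a < h)
               (if vcol S i a is Some c then vdens c else 1)) *
            (\prod_(i < r) \prod_(j < r | (i < j)%N)
               \prod_(a < h) \prod_(b < h | ecol S i j a b != None)
                 t i j a b)
    & forall i j : 'I_r, (i < j)%N ->
        Ex (edge_dist P (i := i) (j := j))
           (fun e => delta i j (ecol G i j e.1 e.2) (vcol G i e.1) (vcol G j e.2))
        <= eps / #|ecols G [set i; j]|%:R].

(* The set of admissible eps is closed, and for r >= 2 it is nonempty and
   bounded below by 0, so this infimum is a minimum. *)
Definition reg : R := inf (fun eps : R => regular eps).

End Regularity.

(* Main.v *)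
Require Import Defs.
From HB Require Import structures.
From mathcomp Require Import all_boot all_order all_algebra.
From mathcomp Require Import boolp classical_sets reals.
From mathcomp Require Import ring lra.

Set Implicit Arguments.
Unset Strict Implicit.
Unset Printing Implicit Defensive.

Import Order.TTheory GRing.Theory Num.Theory.

Local Open Scope ring_scope.

(* Call a pair colour c on a pair (A, B) of vertex classes of G/phi bad if the
   weighted number of 4-cycles of the centred function [colour = c] - d exceeds
   eta^4 (P(A) P(B))^2.  With delta := 1 on bad total colours and a small
   constant d0 on the others, the counting identity holds: edges with bad
   colours have the trivial range [0, 1], and the others are replaced by their
   densities one at a time, each at a cost at most eta by Cauchy-Schwarz.

   Bad colours have small total mass for most n.  The energy, i.e. the mean
   square density over the classes, is at most 1 and increases with n.  If
   (A, B) is bad, then once the fresh samples contain a point x' of A and a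
   point y' of B, the neighbourhoods of x' and y' are unions of refined classes,
   and the average over (x', y') of their correlation with the centred function
   is the 4-cycle count, so the energy over A x B grows by a constant times
   P(A) P(B).  Fresh samples hit every class that is not tiny provided m(n+1) is
   large in terms of the number of classes of G/phi for phi in Phi(m(n)). *)

(* Defs.pmap is hidden by the partial map of seq.v. *)
Local Notation pmap := Defs.pmap.

(** * Cauchy-Schwarz and 4-cycles *)

Lemma weighted_cauchy_schwarz (R : realFieldType) (I : finType)
    (w f g : I -> R) : (forall i, 0 <= w i) ->
  (\sum_i w i * (f i * g i)) ^+ 2 <=
  (\sum_i w i * f i ^+ 2) * (\sum_i w i * g i ^+ 2).
Proof.
move=> w0; set b := \sum_i _; set a := \sum_i _; set c := \sum_i _.
have quad t s : 0 <= a * t ^+ 2 - b * t * s *+ 2 + c * s ^+ 2.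
  have -> : a * t ^+ 2 - b * t * s *+ 2 + c * s ^+ 2 =
            \sum_i w i * (f i * t - g i * s) ^+ 2.
    rewrite -mulrA -mulrnAr /a /b /c !mulr_suml -sumrB -big_split /=.
    by apply: eq_bigr => i _; ring.
  by apply: sumr_ge0 => i _; rewrite mulr_ge0 ?sqr_ge0.
have c0 : 0 <= c by apply: sumr_ge0 => i _; rewrite mulr_ge0 ?sqr_ge0.
have [c_eq0|c_neq0] := eqVneq c 0; last first.
  have cp : 0 < c by rewrite lt_neqAle eq_sym c_neq0.
  have := quad c b.
  have -> : a * c ^+ 2 - b * c * b *+ 2 + c * b ^+ 2 = c * (a * c - b ^+ 2).
    by ring.
  by rewrite pmulr_rge0 // subr_ge0.
have [-> |b0] := eqVneq b 0; first by rewrite c_eq0 expr0n mulr0.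
(* With c = 0 and t = 1 the form is a - 2bs, and this s gives it the value -1, so b must vanish. *)
have := quad 1 ((a + 1) / (b *+ 2)); rewrite c_eq0.
have -> : a * 1 ^+ 2 - b * 1 * ((a + 1) / (b *+ 2)) *+ 2 +
  0 * ((a + 1) / (b *+ 2)) ^+ 2 = -1 by field.
by rewrite oppr_ge0 ler10.
Qed.

Section FourCycles.
Variables (R : realFieldType) (T U : finType) (p : T -> R) (q : U -> R).
Variable g : T -> U -> R.
Hypotheses (p0 : forall x, 0 <= p x) (q0 : forall y, 0 <= q y).

Definition four_cycles : R :=
  \sum_x \sum_x' p x * p x' * (\sum_y q y * (g x y * g x' y)) ^+ 2.

(** The three edges of a 4-cycle other than x'y'. For fixed x' and y' the factor [g x y' * g x' y]
    is a function of x times a function of y, the form tested in the energy increment. *)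
Definition three_paths (x' : T) (y' : U) : R :=
  \sum_x \sum_y p x * q y * (g x y * (g x y' * g x' y)).

Lemma four_cyclesE :
  four_cycles = \sum_x' \sum_y' p x' * q y' * (g x' y' * three_paths x' y').
Proof.
rewrite /four_cycles exchange_big; apply: eq_bigr => x' _.
transitivity (\sum_x \sum_y' p x' * q y' * (g x' y' *
    \sum_y p x * q y * (g x y * (g x y' * g x' y)))).
  apply: eq_bigr => x _; rewrite expr2 !mulr_sumr; apply: eq_bigr => y' _.
  rewrite mulr_sumr !mulr_suml !mulr_sumr.
  by apply: eq_bigr => y _; ring.
rewrite exchange_big; apply: eq_bigr => y' _.
by rewrite /three_paths !mulr_sumr.
Qed.

(** Cauchy-Schwarz over y removes v. Expanding the square gives the sum N over pairs (x, x'), and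
    Cauchy-Schwarz over these pairs removes u. *)
Lemma cut_le_four_cycles (u : T -> R) (v : U -> R) :
  (forall x, 0 <= u x <= 1) -> (forall y, 0 <= v y <= 1) ->
  (\sum_x \sum_y p x * q y * (g x y * (u x * v y))) ^+ 4 <=
  (\sum_x p x) ^+ 2 * (\sum_y q y) ^+ 2 * four_cycles.
Proof.
move=> u01 v01.
have sq01 a : 0 <= a <= 1 -> a ^+ 2 <= 1 :> R.
  by case/andP=> a0 a1; rewrite expr_le1.
pose S := \sum_x \sum_y p x * q y * (g x y * (u x * v y)).
pose N := \sum_x \sum_x' p x * p x' *
  ((u x * u x') * \sum_y q y * (g x y * g x' y)).
have S2 : S ^+ 2 <= (\sum_y q y) * N.
  have -> : S = \sum_y q y * (v y * \sum_x p x * (g x y * u x)).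
    rewrite /S exchange_big; apply: eq_bigr => y _.
    by rewrite !mulr_sumr; apply: eq_bigr => x _; ring.
  apply: le_trans (weighted_cauchy_schwarz _ _ q0) _.
  have -> : N = \sum_y q y * (\sum_x p x * (g x y * u x)) ^+ 2.
    rewrite /N; transitivity (\sum_x \sum_y \sum_x'
        p x * p x' * ((u x * u x') * (q y * (g x y * g x' y)))).
      apply: eq_bigr => x _; rewrite exchange_big; apply: eq_bigr => x' _.
      by rewrite !mulr_sumr.
    rewrite exchange_big; apply: eq_bigr => y _; rewrite expr2 mulr_suml mulr_sumr.
    apply: eq_bigr => x _; rewrite !mulr_sumr.
    by apply: eq_bigr => x' _; ring.
  apply: ler_wpM2r; first by apply: sumr_ge0 => y _; rewrite mulr_ge0 ?sqr_ge0.
  by apply: ler_sum => y _; rewrite ler_piMr // sq01.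
have N2 : N ^+ 2 <= (\sum_x p x) ^+ 2 * four_cycles.
  rewrite /N pair_bigA /=.
  have pp0 (z : T * T) : 0 <= p z.1 * p z.2 by rewrite mulr_ge0.
  apply: le_trans (weighted_cauchy_schwarz _ _ pp0) _.
  rewrite /four_cycles [\sum_x \sum_x' _]pair_bigA /=.
  apply: ler_wpM2r; first by apply: sumr_ge0 => y _; rewrite mulr_ge0 ?sqr_ge0.
  rewrite expr2 big_distrlr /= pair_bigA /=; apply: ler_sum => z _.
  rewrite ler_piMr //; apply: sq01.
  have /andP[a0 a1] := u01 z.1; have /andP[b0 b1] := u01 z.2.
  by rewrite mulr_ge0 //= mulr_ile1.
rewrite -/S -[4%N]/(2 * 2)%N exprM.
apply: (@le_trans _ _ (((\sum_y q y) * N) ^+ 2)).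
  by rewrite lerXn2r ?nnegrE ?sqr_ge0 // (le_trans _ S2) ?sqr_ge0.
rewrite exprMn mulrC.
apply: le_trans (ler_wpM2r (sqr_ge0 _) N2) _.
by rewrite mulrAC.
Qed.

End FourCycles.

(** * The product measure on partitionwise maps *)

Lemma big_dffun_distr (R : comPzSemiRingType) (I : finType) (T : I -> finType)
    (F : forall i, T i -> R) :
  \sum_(f : {dffun forall i, T i}) \prod_i F i (f i) = \prod_i \sum_x F i x.
Proof.
rewrite (reindex (@dffun_of_fprod I T)); last first.
  exact/onW_bij/dffun_of_fprod_bij.
transitivity (\sum_(t : fprod T) \prod_(i in I) [ffun x => F i x] (t i)).
  by apply: eq_bigr => t _; apply: eq_bigr => i _; rewrite !ffunE.
rewrite (big_fprod _ _ (fun i => [ffun x => F i x])) /=.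
under [RHS]eq_bigr do rewrite (big_tag (fun i x => F i x)).
rewrite bigA_distr_big_dep; apply: eq_bigr => g _; apply: eq_bigr => i _.
by rewrite /untag; case: eqP => // e; rewrite ffunE.
Qed.

Section ProductMeasure.
Variables (R : realType) (r : nat) (Omega : 'I_r -> finType).
Variable P : forall i, fdist R (Omega i).

Lemma sum_pmap_prod m (F : forall i, 'I_m -> Omega i -> R) :
  \sum_(phi : pmap Omega m) \prod_i \prod_w F i w (phi i w) =
  \prod_i \prod_w \sum_x F i w x.
Proof.
under [RHS]eq_bigr do rewrite bigA_distr_bigA.
exact: (big_dffun_distr (fun i (f : {ffun 'I_m -> Omega i}) =>
  \prod_w F i w (f w))).
Qed.

Notation E m := (Ex (pmap_dist P (m := m))).

Lemma pmap_dist_ge0 m (phi : pmap Omega m) : 0 <= pmap_dist P phi.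
Proof. by do 2 apply: prodr_ge0 => ? _; exact: pmf_ge0. Qed.

Lemma Ex_pmap_prod m (F : forall i, 'I_m -> Omega i -> R) :
  E m (fun phi => \prod_i \prod_w F i w (phi i w)) =
  \prod_i \prod_w \sum_x P i x * F i w x.
Proof.
rewrite -sum_pmap_prod; apply: eq_bigr => phi _.
rewrite -big_split /=; apply: eq_bigr => i _.
by rewrite -big_split.
Qed.

Lemma Ex_pmap_cst m c : E m (fun=> c) = c.
Proof.
rewrite /Ex -mulr_suml -[RHS]mul1r; congr (_ * _).
rewrite (sum_pmap_prod (fun i (_ : 'I_m) x => P i x)).
by rewrite big1 // => i _; rewrite big1 // => w _; rewrite pmf_sum1.
Qed.

Lemma Ex_pmap_le m (F H : pmap Omega m -> R) :
  (forall phi, F phi <= H phi) -> E m F <= E m H.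
Proof.
by move=> FH; apply: ler_sum => phi _; rewrite ler_wpM2l ?pmap_dist_ge0.
Qed.

Lemma Ex_pmap_ge0 m (F : pmap Omega m -> R) :
  (forall phi, 0 <= F phi) -> 0 <= E m F.
Proof. by move=> F0; apply: sumr_ge0 => phi _; rewrite mulr_ge0 ?pmap_dist_ge0. Qed.

Lemma eq_Ex m (F H : pmap Omega m -> R) : F =1 H -> E m F = E m H.
Proof. by move=> FH; apply: eq_bigr => phi _; rewrite FH. Qed.

Lemma Ex_pmapD m (F H : pmap Omega m -> R) :
  E m (fun phi => F phi + H phi) = E m F + E m H.
Proof. by rewrite /Ex -big_split; apply: eq_bigr => phi _; rewrite mulrDr. Qed.

Lemma Ex_pmapZ m c (F : pmap Omega m -> R) :
  E m (fun phi => c * F phi) = c * E m F.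
Proof. by rewrite /Ex mulr_sumr; apply: eq_bigr => phi _; rewrite mulrCA. Qed.

Lemma Ex_pmapB m (F H : pmap Omega m -> R) :
  E m (fun phi => F phi - H phi) = E m F - E m H.
Proof. by rewrite /Ex -sumrB; apply: eq_bigr => phi _; rewrite mulrBr. Qed.

Lemma Ex_pmap_sum m (I : Type) (s : seq I) (Q : pred I)
    (F : I -> pmap Omega m -> R) :
  E m (fun phi => \sum_(k <- s | Q k) F k phi) = \sum_(k <- s | Q k) E m (F k).
Proof.
by rewrite /Ex exchange_big; apply: eq_bigr => phi _; rewrite mulr_sumr.
Qed.

Lemma Ex_pmap_norm m (F : pmap Omega m -> R) :
  `|E m F| <= E m (fun phi => `|F phi|).
Proof.
apply: le_trans (ler_norm_sum _ _ _) _; apply: ler_sum => phi _.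
by rewrite normrM ger0_norm ?pmap_dist_ge0.
Qed.

Definition upd m (phi : pmap Omega m) i (a : 'I_m) (x : Omega i) : pmap Omega m :=
  [ffun k => dfwith (fun k => phi k) [ffun b => if b == a then x else phi i b] k].

Lemma upd_same m (phi : pmap Omega m) i (a : 'I_m) (x : Omega i) :
  upd phi a x i a = x.
Proof. by rewrite ffunE dfwith_in ffunE eqxx. Qed.

Lemma upd_other m (phi : pmap Omega m) i (a : 'I_m) (x : Omega i) j b :
  (i, a) != (j, b) -> upd phi a x j b = phi j b.
Proof.
rewrite xpair_eqE negb_and => ne; rewrite ffunE.
case: (eqVneq i j) ne => [e|ij _]; last by rewrite dfwith_out.
case: j / e b => b /=; rewrite dfwith_in ffunE eq_sym.
by case: eqP.
Qed.

Lemma upd_eq m (phi psi : pmap Omega m) i (a : 'I_m) (x : Omega i) :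
  psi i a = x -> (forall j b, (i, a) != (j, b) -> psi j b = phi j b) ->
  upd phi a x = psi.
Proof.
move=> e ne; apply/ffunP => j; apply/ffunP => b.
have [[? ?]|d] := eqVneq (i, a) (j, b); last by rewrite upd_other // ne.
by subst; rewrite upd_same.
Qed.

Lemma pmap_dist_upd m (phi : pmap Omega m) i (a : 'I_m) (x : Omega i) :
  pmap_dist P (upd phi a x) * P i (phi i a) = pmap_dist P phi * P i x.
Proof.
rewrite /pmap_dist !pair_bigA /= [X in X * _](bigD1 (i, a)) //=.
rewrite [X in _ = X * _](bigD1 (i, a)) //= upd_same.
set A := \prod_(_ | _) _; set B := \prod_(_ | _) _.
suff -> : A = B by ring.
apply: eq_bigr => -[j b] /= ne; rewrite upd_other //; by rewrite eq_sym.
Qed.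

(* Exchanging phi i a with a fresh point x is a measure-preserving involution of
   the pairs (phi, x). *)
Lemma Ex_resample m i (a : 'I_m) (F : pmap Omega m -> R) :
  E m F = E m (fun phi => \sum_x P i x * F (upd phi a x)).
Proof.
rewrite /Ex; under [RHS]eq_bigr do rewrite mulr_sumr.
rewrite pair_bigA /=.
pose sw (z : pmap Omega m * Omega i) := (upd z.1 a z.2, z.1 i a).
have swK : involutive sw.
  case=> phi x; rewrite /sw /= upd_same; congr pair.
  by apply: upd_eq => // j b ne; rewrite upd_other.
rewrite (reindex_inj (inv_inj swK)) /=.
transitivity (\sum_(phi : pmap Omega m) \sum_x pmap_dist P phi * (P i x * F phi)).
  apply: eq_bigr => phi _; rewrite -mulr_sumr -mulr_suml pmf_sum1 mul1r //.
rewrite pair_bigA; apply: eq_bigr => -[phi x] _ /=.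
have -> : upd (upd phi a x) a (phi i a) = phi.
  by have [->] := swK (phi, x).
by rewrite !mulrA pmap_dist_upd.
Qed.

Definition pmap_join m k (phi : pmap Omega m) (psi : pmap Omega k) :
    pmap Omega (m + k) :=
  [ffun i => [ffun w => match split w with inl u => phi i u | inr v => psi i v end]].

Lemma pmap_joinl m k (phi : pmap Omega m) (psi : pmap Omega k) i w :
  pmap_join phi psi i (lshift k w) = phi i w.
Proof. by rewrite !ffunE (unsplitK (inl w)). Qed.

Lemma pmap_joinr m k (phi : pmap Omega m) (psi : pmap Omega k) i w :
  pmap_join phi psi i (rshift m w) = psi i w.
Proof. by rewrite !ffunE (unsplitK (inr w)). Qed.

(** Samples are independent, so the last k of them are fresh given the first m. This compares G/phi
    with its refinement at the next sample size. *)
Lemma Ex_pmap_join m k (F : pmap Omega (m + k) -> R) :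
  E (m + k) F = E m (fun phi => E k (fun psi => F (pmap_join phi psi))).
Proof.
pose J (z : pmap Omega m * pmap Omega k) := pmap_join z.1 z.2.
pose L (phi : pmap Omega (m + k)) : pmap Omega m * pmap Omega k :=
  ([ffun i => [ffun w => phi i (lshift k w)]],
   [ffun i => [ffun w => phi i (rshift m w)]]).
have JL : cancel L J.
  move=> phi; apply/ffunP => i; apply/ffunP => w; rewrite !ffunE.
  by case: (splitP w) => u e; rewrite !ffunE; congr (phi i _); apply: val_inj.
have LJ : cancel J L.
  case=> phi psi; congr pair; apply/ffunP => i; apply/ffunP => w.
    by rewrite ffunE ffunE; apply: pmap_joinl.
  by rewrite ffunE ffunE; apply: pmap_joinr.
rewrite /Ex (reindex J); last by exists L => z _; [apply: LJ|apply: JL].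
under [RHS]eq_bigr do rewrite mulr_sumr.
rewrite pair_bigA; apply: eq_bigr => -[phi psi] _ /=; rewrite mulrA.
congr (_ * _); rewrite /pmap_dist -big_split /=; apply: eq_bigr => i _.
rewrite big_split_ord /=; congr (_ * _); apply: eq_bigr => w _.
  by rewrite pmap_joinl.
by rewrite pmap_joinr.
Qed.

End ProductMeasure.

(** * Hitting classes with random samples *)

Lemma PrE (R : realType) (T : finType) (p : T -> R) (A : pred T) :
  Pr p A = \sum_x p x * (A x)%:R.
Proof.
by rewrite /Pr big_mkcond; apply: eq_bigr => x _; case: (A x); rewrite ?(mulr1, mulr0).
Qed.

Lemma Pr_ge0 (R : realType) (T : finType) (p : fdist R T) (A : pred T) :
  0 <= Pr p A.
Proof. by apply: sumr_ge0 => x _; apply: pmf_ge0. Qed.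

Lemma Pr_le1 (R : realType) (T : finType) (p : fdist R T) (A : pred T) :
  Pr p A <= 1.
Proof.
rewrite -(pmf_sum1 p) PrE; apply: ler_sum => x _.
by case: (A x); rewrite ?(mulr1, mulr0) ?pmf_ge0.
Qed.

Section FirstHit.
Variables (R : realType) (r : nat) (Omega : 'I_r -> finType).
Variables (P : forall i, fdist R (Omega i)) (K : nat).

Notation E := (Ex (pmap_dist P (m := K))).

Local Notation mass A := (Pr (P _) A).

(** k is a natural number rather than an ordinal, so that k = K, no hit at all, is included. *)
Definition missed i (A : pred (Omega i)) (psi : pmap Omega K) (k : nat) : bool :=
  [forall w : 'I_K, (w < k)%N ==> ~~ A (psi i w)].

Definition first_hit i (A : pred (Omega i)) (psi : pmap Omega K) (w : 'I_K) :=
  A (psi i w) && missed A psi w.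

Lemma missed_upd i (A : pred (Omega i)) psi j (w : 'I_K) (x : Omega j) (k : nat) :
  (i != j) || (k <= w)%N -> missed A (upd psi w x) k = missed A psi k.
Proof.
move=> h; apply: eq_forallb => v; have [vk|//] := boolP (v < k)%N.
rewrite upd_other // xpair_eqE negb_and eq_sym.
case/orP: h => [->//|kw]; apply/orP; right.
by apply: contraTneq vk => <-; rewrite -leqNgt.
Qed.

(** Resampling the last point concerned gives one factor [1 - mass A], and [missed_upd] leaves the
    condition on smaller indices untouched. *)
Lemma Ex_missed i (A : pred (Omega i)) k : (k <= K)%N ->
  E (fun psi => (missed A psi k)%:R) = (1 - mass A) ^+ k.
Proof.
elim: k => [_|k IH kK].
  rewrite expr0 -[RHS](Ex_pmap_cst P K); apply: eq_Ex => psi.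
  by have -> : missed A psi 0 by apply/forallP.
rewrite exprS -IH ?(ltnW kK) // (Ex_resample P i (Ordinal kK)) -Ex_pmapZ.
apply: eq_Ex => psi.
have Mk x : missed A (upd psi (Ordinal kK) x) k.+1 = missed A psi k && ~~ A x.
  rewrite -(@missed_upd _ _ psi i (Ordinal kK) x) ?leqnn ?orbT //.
  apply/forallP/andP => [Q|[/forallP Q Ax] w].
    split; last by have := Q (Ordinal kK); rewrite ltnS leqnn upd_same.
    by apply/forallP => w; apply/implyP => wk; have := Q w; rewrite ltnW.
  rewrite ltnS leq_eqVlt; case: eqP => [wk|_ /=]; last exact: Q.
  have -> : w = Ordinal kK by apply: val_inj.
  by rewrite upd_same Ax implybT.
under eq_bigr => x _ do rewrite Mk.
rewrite -[X in X - _](pmf_sum1 (P i)) PrE -sumrB mulr_suml.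
by apply: eq_bigr => x _; case: (missed _ _ _); case: (A x) => /=; ring.
Qed.

Lemma sum_first_hit i (A : pred (Omega i)) psi :
  \sum_w (first_hit A psi w)%:R = 1 - (missed A psi K)%:R :> R.
Proof.
have [/forallP M|] := boolP (missed A psi K).
  rewrite subrr big1 // => w _; have := M w; rewrite ltn_ord /= /first_hit.
  by case: (A _).
rewrite subr0; case/forallPn => w0; rewrite ltn_ord negb_imply /= negbK => Aw0.
case: (@arg_minnP _ w0 (fun w => A (psi i w)) (fun w : 'I_K => w : nat) Aw0).
move=> w1 Aw1 min1.
have fh1 : first_hit A psi w1.
  rewrite /first_hit Aw1; apply/forallP => w; apply/implyP; apply: contraTN => Aw.
  by rewrite -leqNgt min1.
rewrite (bigD1 w1) //= fh1 big1 ?addr0 // => w ne.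
case: (boolP (first_hit A psi w)) => // /andP[Aw /forallP /(_ w1)].
rewrite Aw1 implybF -leqNgt => le_w; case/eqP: ne; apply/val_inj/eqP.
by rewrite eqn_leq le_w min1.
Qed.

(** Both hit points can be resampled: [missed A psi w] only looks at indices below w, and i != j
    keeps the two parts apart. *)
Lemma Ex_first_hits i j (A : pred (Omega i)) (B : pred (Omega j)) (w w' : 'I_K)
    (u : Omega i -> Omega j -> R) : i != j ->
  E (fun psi => (first_hit A psi w)%:R * (first_hit B psi w')%:R *
                u (psi i w) (psi j w')) =
  E (fun psi => (missed A psi w)%:R * (missed B psi w')%:R) *
  \sum_x \sum_y (P i x * (A x)%:R) * (P j y * (B y)%:R) * u x y.
Proof.
move=> ij; rewrite (Ex_resample P i w) (Ex_resample P j w') mulrC -Ex_pmapZ.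
apply: eq_Ex => psi.
rewrite exchange_big mulr_suml; apply: eq_bigr => y _.
rewrite mulr_sumr mulr_suml; apply: eq_bigr => x _.
rewrite /first_hit upd_same (@upd_other _ _ _ _ i) ?xpair_eqE ?(negPf ij) //.
rewrite upd_same !missed_upd ?ij ?(eq_sym j) ?ij ?leqnn ?orbT //.
by case: (A x); case: (B y); rewrite /= ?(mulr0, mul0r, mulr1) //; ring.
Qed.

(* Splitting according to the indices of the first samples in A and in B makes
   these two samples independent of the remaining conditions. *)
Lemma Ex_hit_ge i j (A : pred (Omega i)) (B : pred (Omega j))
    (F : pmap Omega K -> R) (u : Omega i -> Omega j -> R) : i != j ->
  (forall psi, 0 <= F psi) -> (forall x y, 0 <= u x y) ->
  (forall (psi : pmap Omega K) w w', A (psi i w) -> B (psi j w') ->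
     u (psi i w) (psi j w') <= F psi) ->
  (1 - (1 - mass A) ^+ K - (1 - mass B) ^+ K) *
    \sum_x \sum_y (P i x * (A x)%:R) * (P j y * (B y)%:R) * u x y
  <= mass A * mass B * E F.
Proof.
move=> ij F0 u0 uF; set S := \sum_x _.
have S0 : 0 <= S.
  by do 2 apply: sumr_ge0 => ? _; rewrite !mulr_ge0 ?pmf_ge0 ?ler0n.
have sum_u : \sum_w \sum_w' E (fun psi => (first_hit A psi w)%:R *
    (first_hit B psi w')%:R * u (psi i w) (psi j w')) <= E F.
  under eq_bigr do rewrite -Ex_pmap_sum.
  rewrite -Ex_pmap_sum; apply: Ex_pmap_le => psi.
  apply: (@le_trans _ _ (\sum_w \sum_w'
      (first_hit A psi w)%:R * (first_hit B psi w')%:R * F psi)).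
    apply: ler_sum => w _; apply: ler_sum => w' _.
    case fA: (first_hit A psi w); case fB: (first_hit B psi w');
      rewrite ?(mul0r, mulr0, mul1r) //.
    by case/andP: fA => ? _; case/andP: fB => ? _; apply: uF.
  under eq_bigr do rewrite -mulr_suml; rewrite -mulr_suml -big_distrlr /=.
  rewrite !sum_first_hit; case: (missed _ _ _); case: (missed _ _ _) => /=;
    by rewrite ?(subrr, subr0, mul0r, mulr0, mul1r).
(* With u = 1 the sum is the probability that both classes are hit, bounded below by the union
   bound. *)
have hits : 1 - (1 - mass A) ^+ K - (1 - mass B) ^+ K <=
    \sum_w \sum_w' E (fun psi => (first_hit A psi w)%:R *
       (first_hit B psi w')%:R * 1).
  under eq_bigr do rewrite -Ex_pmap_sum.
  rewrite -Ex_pmap_sum -!Ex_missed //.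
  have -> (a b : pmap Omega K -> R) : 1 - E a - E b = E (fun psi => 1 - a psi - b psi).
    by rewrite !Ex_pmapB Ex_pmap_cst.
  apply: Ex_pmap_le => psi.
  under eq_bigr do under eq_bigr do rewrite mulr1.
  rewrite -big_distrlr /= !sum_first_hit.
  by case: (missed _ _ _); case: (missed _ _ _) => /=; lra.
apply: le_trans (ler_wpM2r S0 hits) _.
apply: le_trans (ler_wpM2l _ sum_u); last first.
  by rewrite mulr_ge0 // Pr_ge0.
rewrite mulr_suml mulr_sumr; apply: ler_sum => w _.
rewrite mulr_suml mulr_sumr; apply: ler_sum => w' _.
(* For each w, w' both sides are [mass A * mass B * S] times the probability that A is missed before
   w and B before w', so no division by masses occurs. *)
rewrite (Ex_first_hits A B w w' (fun _ _ => 1) ij) Ex_first_hits // -/S.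
have -> : \sum_x \sum_y P i x * (A x)%:R * (P j y * (B y)%:R) * 1 = mass A * mass B.
  rewrite !PrE big_distrlr; apply: eq_bigr => x _; apply: eq_bigr => y _.
  by rewrite mulr1.
by rewrite [_ * (mass A * mass B)]mulrC -mulrA.
Qed.

End FirstHit.

(** * Densities and energy of a pair of partitions *)

Definition class (T L : finType) (a : T -> L) (l : L) : pred T :=
  fun x => a x == l.

Definition cellw (R : realType) (T L : finType) (p : T -> R) (a : T -> L) (l : L)
    (x : T) : R :=
  p x * (class a l x)%:R.

Section Cells.
Variables (R : realType) (T U : finType) (p : fdist R T) (q : fdist R U).
Variable f : T -> U -> bool.

Section Labels.
Variables (KA KB : finType) (a : T -> KA) (b : U -> KB).

Notation pa := (cellw p a).
Notation qb := (cellw q b).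
Notation ma l := (Pr p (class a l)).
Notation mb l := (Pr q (class b l)).

Lemma cellw_ge0 (S L : finType) (s : fdist R S) (c : S -> L) l x :
  0 <= cellw s c l x.
Proof. by rewrite mulr_ge0 ?pmf_ge0 ?ler0n. Qed.

Lemma sum_cellw (S L : finType) (s : fdist R S) (c : S -> L) l :
  \sum_x cellw s c l x = Pr s (class c l).
Proof. by rewrite PrE. Qed.

Lemma sum_cellw2 la lb : \sum_x \sum_y pa la x * qb lb y = ma la * mb lb.
Proof. by rewrite -!sum_cellw big_distrlr. Qed.

Definition dens (la : KA) (lb : KB) : R :=
  (\sum_x \sum_y pa la x * qb lb y * (f x y)%:R) / (ma la * mb lb).

(** On a null cell both sides vanish, since the left one lies between 0 and the mass of the cell. *)
Lemma sum_dens la lb :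
  \sum_x \sum_y pa la x * qb lb y * (f x y)%:R = dens la lb * (ma la * mb lb).
Proof.
rewrite /dens; have [M0|M0] := eqVneq (ma la * mb lb) 0; last by rewrite divfK.
rewrite M0 mulr0; apply/eqP; rewrite eq_le; apply/andP; split.
  rewrite -[leRHS]M0 -sum_cellw2; apply: ler_sum => x _; apply: ler_sum => y _.
  by rewrite ler_piMr ?lern1 ?leq_b1 // mulr_ge0 ?cellw_ge0.
by do 2 apply: sumr_ge0 => ? _; rewrite !mulr_ge0 ?pmf_ge0 ?ler0n.
Qed.

Lemma dens_ge0 la lb : 0 <= dens la lb.
Proof.
rewrite divr_ge0 ?mulr_ge0 ?Pr_ge0 //.
by do 2 apply: sumr_ge0 => ? _; rewrite !mulr_ge0 ?pmf_ge0 ?ler0n.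
Qed.

Lemma dens_le1 la lb : dens la lb <= 1.
Proof.
rewrite /dens; have [->|M0] := eqVneq (ma la * mb lb) 0.
  by rewrite invr0 mulr0 ler01.
rewrite ler_pdivrMr ?mul1r; last by rewrite lt_neqAle eq_sym M0 mulr_ge0 ?Pr_ge0.
rewrite -sum_cellw2; apply: ler_sum => x _; apply: ler_sum => y _.
by rewrite ler_piMr ?lern1 ?leq_b1 // mulr_ge0 ?cellw_ge0.
Qed.

Lemma sum_by_cell (F : T -> U -> KA -> KB -> R) :
  \sum_x \sum_y p x * q y * F x y (a x) (b y) =
  \sum_la \sum_lb \sum_x \sum_y pa la x * qb lb y * F x y la lb.
Proof.
have E x y : p x * q y * F x y (a x) (b y) =
    \sum_la \sum_lb pa la x * qb lb y * F x y la lb.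
  rewrite (bigD1 (a x)) //= (bigD1 (b y)) //= /cellw /class !eqxx !mulr1.
  rewrite [X in _ = _ + X + _]big1 ?addr0; last first.
    by move=> l nl; rewrite [_ == l]eq_sym (negPf nl) mulr0 mulr0 mul0r.
  rewrite [X in _ = _ + X]big1 ?addr0 // => l nl; rewrite big1 // => l' _.
  by rewrite [_ == l]eq_sym (negPf nl) mulr0 !mul0r.
under eq_bigr do under eq_bigr do rewrite E.
under eq_bigr do rewrite exchange_big.
rewrite exchange_big; apply: eq_bigr => la _.
under eq_bigr do rewrite exchange_big.
by rewrite exchange_big.
Qed.

(** On each cell the density is the mean of f and F is constant, so the deviations of f cancel. *)
Lemma dens_orth (F : T -> U -> R) :
  (forall x x' y y', a x = a x' -> b y = b y' -> F x y = F x' y') ->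
  \sum_x \sum_y p x * q y * (((f x y)%:R - dens (a x) (b y)) * F x y) = 0.
Proof.
move=> FE.
(* F as a function of the labels, through a representative of each class; unoccupied labels get
   0. *)
pose H la lb := if [pick x | a x == la] is Some x then
  if [pick y | b y == lb] is Some y then F x y else 0 else 0.
have HE x y : F x y = H (a x) (b y).
  rewrite /H; case: pickP => [x' /eqP ex|/(_ x)]; last by rewrite eqxx.
  case: pickP => [y' /eqP ey|/(_ y)]; last by rewrite eqxx.
  exact: FE.
under eq_bigr do under eq_bigr do rewrite HE.
rewrite (sum_by_cell (fun x y la lb => ((f x y)%:R - dens la lb) * H la lb)).
rewrite big1 // => la _; rewrite big1 // => lb _.
transitivity (H la lb * (\sum_x \sum_y pa la x * qb lb y * (f x y)%:R
   - dens la lb * \sum_x \sum_y pa la x * qb lb y)).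
  rewrite mulrBr !mulr_sumr -sumrB; apply: eq_bigr => x _.
  rewrite !mulr_sumr -sumrB; apply: eq_bigr => y _; ring.
by rewrite sum_dens sum_cellw2 subrr mulr0.
Qed.

Definition energy : R := \sum_x \sum_y p x * q y * dens (a x) (b y) ^+ 2.

Lemma energy_ge0 : 0 <= energy.
Proof.
by do 2 apply: sumr_ge0 => ? _; rewrite mulr_ge0 ?sqr_ge0 // mulr_ge0 ?pmf_ge0.
Qed.

Lemma energy_le1 : energy <= 1.
Proof.
apply: (@le_trans _ _ (\sum_x \sum_y p x * q y)).
  apply: ler_sum => x _; apply: ler_sum => y _.
  rewrite ler_piMr ?mulr_ge0 ?pmf_ge0 // expr_le1 // ?dens_ge0 ?dens_le1 //.
by rewrite -big_distrlr /= !pmf_sum1 mulr1.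
Qed.

Definition dev la lb x y : R := (f x y)%:R - dens la lb.

Lemma dev_le1 la lb x y : `|dev la lb x y| <= 1.
Proof.
rewrite /dev ler_norml; have := dens_ge0 la lb; have := dens_le1 la lb.
by case: (f x y) => /=; lra.
Qed.

End Labels.

Section Refinement.
Variables (KA KB KA' KB' : finType).
Variables (a : T -> KA) (b : U -> KB) (a' : T -> KA') (b' : U -> KB').
Hypothesis refa : forall x x', a' x = a' x' -> a x = a x'.
Hypothesis refb : forall y y', b' y = b' y' -> b y = b y'.

Notation d la lb := (dens a b la lb).
Notation d' x y := (dens a' b' (a' x) (b' y)).

Definition increment la lb : R :=
  \sum_x \sum_y cellw p a la x * cellw q b lb y * (d' x y - d la lb) ^+ 2.

Lemma increment_ge0 la lb : 0 <= increment la lb.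
Proof.
do 2 apply: sumr_ge0 => ? _; rewrite mulr_ge0 ?sqr_ge0 //.
by rewrite mulr_ge0 ?cellw_ge0.
Qed.

(** Pythagoras: [S1] and [S2] vanish by [dens_orth], as d is constant on refined and on coarse
    cells, and adding [2 * (S1 - S2)] completes the square. *)
Lemma energy_increment :
  energy a' b' - energy a b = \sum_la \sum_lb increment la lb.
Proof.
rewrite /increment -(sum_by_cell a b (fun x y la lb => (d' x y - d la lb) ^+ 2)).
pose S1 := \sum_x \sum_y p x * q y * (((f x y)%:R - d' x y) * d (a x) (b y)).
pose S2 := \sum_x \sum_y p x * q y *
    (((f x y)%:R - d (a x) (b y)) * d (a x) (b y)).
have o1 : S1 = 0.
  by apply: dens_orth => x x' y y' /refa -> /refb ->.
have o2 : S2 = 0.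
  by apply: dens_orth => x x' y y' -> ->.
transitivity (energy a' b' - energy a b + 2 * (S1 - S2)).
  by rewrite o1 o2 subrr mulr0 addr0.
rewrite /energy /S1 /S2 -!sumrB mulr_sumr -big_split.
apply: eq_bigr => x _; rewrite -!sumrB mulr_sumr -big_split.
by apply: eq_bigr => y _ /=; ring.
Qed.

(* The average of f over the refined cells may replace f when tested against
   functions s, t that are constant on the refined classes. *)
Lemma increment_ge la lb (s : T -> R) (t : U -> R) :
  (forall x x', a' x = a' x' -> s x = s x') ->
  (forall y y', b' y = b' y' -> t y = t y') ->
  (forall x, `|s x| <= 1) -> (forall y, `|t y| <= 1) ->
  (\sum_x \sum_y cellw p a la x * cellw q b lb y *
      (dev a b la lb x y * (s x * t y))) ^+ 2
  <= Pr p (class a la) * Pr q (class b lb) * increment la lb.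
Proof.
move=> sE tE s1 t1.
have -> : \sum_x \sum_y cellw p a la x * cellw q b lb y *
      (dev a b la lb x y * (s x * t y)) =
    \sum_x \sum_y cellw p a la x * cellw q b lb y *
      ((s x * t y) * (d' x y - d la lb)).
  apply/eqP; rewrite -subr_eq0 -sumrB; apply/eqP.
  (* The indicator of the coarse cell is also constant on refined cells, so it joins s and t in the
     test function. *)
  rewrite -[RHS](@dens_orth _ _ a' b' (fun x y => (class a la x)%:R *
    (class b lb y)%:R * (s x * t y))); last first.
    move=> x x' y y' ea eb.
    by rewrite /class (refa ea) (refb eb) (sE _ _ ea) (tE _ _ eb).
  apply: eq_bigr => x _; rewrite -sumrB; apply: eq_bigr => y _.
  by rewrite /cellw /dev; ring.
rewrite !pair_bigA /=.
have w0 (z : T * U) : 0 <= cellw p a la z.1 * cellw q b lb z.2.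
  by rewrite mulr_ge0 ?cellw_ge0.
apply: le_trans (weighted_cauchy_schwarz _ _ w0) _.
rewrite /increment [\sum_x \sum_y _]pair_bigA /=.
apply: ler_wpM2r; first by apply: sumr_ge0 => z _; rewrite mulr_ge0 ?sqr_ge0.
rewrite -sum_cellw2 pair_bigA; apply: ler_sum => z _ /=.
rewrite ler_piMr // -real_normK ?num_real // expr_le1 //.
by rewrite normrM mulr_ile1.
Qed.

End Refinement.

End Cells.

(** * Energy increment of a regularization *)

Section Classes.
Variables (R : realType) (T L : finType) (p : fdist R T) (a : T -> L).

Lemma sum_Pr_class : \sum_l Pr p (class a l) = 1.
Proof.
rewrite -(pmf_sum1 p); under eq_bigr do rewrite PrE.
rewrite exchange_big; apply: eq_bigr => x _ /=; rewrite -mulr_sumr.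
rewrite (bigD1 (a x)) //= /class eqxx big1 ?addr0 ?mulr1 // => l.
by rewrite eq_sym => /negPf ->.
Qed.

(** Labels outside A have empty classes, so the bound counts the colours in A and not the ambient
    type. *)
Lemma small_classes (A : {set L}) (kappa : R) : 0 <= kappa -> (forall x, a x \in A) ->
  \sum_l Pr p (class a l) * (Pr p (class a l) < kappa)%R%:R <= #|A|%:R * kappa.
Proof.
move=> k0 aA; rewrite -sumr_const mulr_suml [leRHS]big_mkcond /=.
apply: ler_sum => l _; case: ifP => lA; last first.
  have -> : Pr p (class a l) = 0; last by rewrite mul0r.
  rewrite /Pr big1 // => x /eqP e.
  by rewrite -e aA in lA.
rewrite mul1r; case: ltP => [/ltW//|_]; last by rewrite mulr0.
by rewrite mulr1.
Qed.

End Classes.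

(** * Pairs of classes with many 4-cycles *)

Section Bad.
Variables (R : realType) (T U : finType) (p : fdist R T) (q : fdist R U).
Variables (f : T -> U -> bool) (KA KB : finType) (a : T -> KA) (b : U -> KB).
Variable theta : R.

Notation m la lb := (Pr p (class a la) * Pr q (class b lb)).

Definition bad la lb : bool :=
  theta * m la lb ^+ 2 <
  four_cycles (cellw p a la) (cellw q b lb) (dev p q f a b la lb).

Definition bad_mass : R := \sum_x \sum_y p x * q y * (bad (a x) (b y))%:R.

Lemma bad_massE : bad_mass = \sum_la \sum_lb m la lb * (bad la lb)%:R.
Proof.
rewrite /bad_mass (sum_by_cell p q a b (fun _ _ la lb => (bad la lb)%:R)).
apply: eq_bigr => la _; apply: eq_bigr => lb _; rewrite -sum_cellw2 mulr_suml.
by apply: eq_bigr => x _; rewrite mulr_suml.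
Qed.

(** Cauchy-Schwarz in [four_cyclesE]; the edge x'y' opened there is a deviation, at most 1 in
    absolute value. *)
Lemma sum_three_paths_ge la lb :
  four_cycles (cellw p a la) (cellw q b lb) (dev p q f a b la lb) ^+ 2 <=
  m la lb * \sum_x \sum_y cellw p a la x * cellw q b lb y *
    three_paths (cellw p a la) (cellw q b lb) (dev p q f a b la lb) x y ^+ 2.
Proof.
rewrite four_cyclesE !pair_bigA /=.
have w0 (z : T * U) : 0 <= cellw p a la z.1 * cellw q b lb z.2.
  by rewrite mulr_ge0 ?cellw_ge0.
apply: le_trans (weighted_cauchy_schwarz _ _ w0) _.
apply: ler_wpM2r; first by apply: sumr_ge0 => z _; rewrite mulr_ge0 ?sqr_ge0.
rewrite -sum_cellw2 pair_bigA; apply: ler_sum => z _ /=.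
by rewrite ler_piMr // -real_normK ?num_real // expr_le1 ?dev_le1.
Qed.

End Bad.

Section GraphIncrement.
Variables (R : realType) (r : nat) (Omega vK : 'I_r -> finType) (eK : finType).
Variables (P : forall i, fdist R (Omega i)) (G : cgraph Omega vK eK).

Lemma reg_vcol_eq m (phi : pmap Omega m) i (x x' : Omega i) :
  reg_vcol G phi x = reg_vcol G phi x' <->
  vcol G i x = vcol G i x' /\
  forall j w, i != j -> ecol G i j x (phi j w) = ecol G i j x' (phi j w).
Proof.
split=> [[e1 e2]|[e1 e2]].
  split=> // j w ij.
  have su : seen phi i (Tagged (fun k => Omega k : Type) (phi j w)).
    by rewrite /seen /= eq_sym ij codom_f.
  by move/ffunP/(_ (exist (seen phi i) _ su)): e2; rewrite !ffunE.
rewrite /reg_vcol e1; congr pair; apply/ffunP => -[[j y] su]; rewrite !ffunE /=.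
by case/andP: su => /= ji /codomP[w ->]; rewrite e2 // eq_sym.
Qed.

(** The colour types of the two regularizations differ, so refinement is expressed through vertices
    of equal colour. The second conclusion makes neighbourhoods of fresh samples unions of refined
    classes. *)
Lemma reg_vcol_join m k (phi : pmap Omega m) (psi : pmap Omega k) i (x x' : Omega i) :
  reg_vcol G (pmap_join phi psi) x = reg_vcol G (pmap_join phi psi) x' ->
  reg_vcol G phi x = reg_vcol G phi x' /\
  forall j w, i != j -> ecol G i j x (psi j w) = ecol G i j x' (psi j w).
Proof.
move/reg_vcol_eq => [e1 e2]; split=> [|j w ij].
  by apply/reg_vcol_eq; split=> // j w ij; rewrite -(pmap_joinl phi psi) e2.
by rewrite -(pmap_joinr phi psi) e2.
Qed.

Variables (i j : 'I_r) (c : eK).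
Hypothesis ij : i != j.

Notation f := (fun x y => ecol G i j x y == c).
Notation va phi := (@reg_vcol r Omega vK eK G _ phi i).
Notation vb phi := (@reg_vcol r Omega vK eK G _ phi j).

Definition graph_energy m (phi : pmap Omega m) : R :=
  energy (P i) (P j) f (va phi) (vb phi).

Definition graph_bad_mass theta m (phi : pmap Omega m) : R :=
  bad_mass (P i) (P j) f (va phi) (vb phi) theta.

Section Step.
Variables (theta : R) (m K : nat) (phi : pmap Omega m).
Hypothesis theta0 : 0 < theta.

Notation E := (Ex (pmap_dist P (m := K))).
Notation ma la := (Pr (P i) (class (va phi) la)).
Notation mb lb := (Pr (P j) (class (vb phi) lb)).
Notation inc la lb psi := (increment (P i) (P j) f (va phi) (vb phi)
  (va (pmap_join phi psi)) (vb (pmap_join phi psi)) la lb).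

Lemma Ex_increment_ge la lb : bad (P i) (P j) f (va phi) (vb phi) theta la lb ->
  0 <= 1 - (1 - ma la) ^+ K - (1 - mb lb) ^+ K ->
  (1 - (1 - ma la) ^+ K - (1 - mb lb) ^+ K) * (theta ^+ 2 * (ma la * mb lb)) <=
  E (fun psi => inc la lb psi).
Proof.
set hit := 1 - _ - _; set M := ma la * mb lb => badc hit0.
set g := dev (P i) (P j) f (va phi) (vb phi) la lb.
set C := four_cycles (cellw (P i) (va phi) la) (cellw (P j) (vb phi) lb) g.
have M0 : 0 <= M by rewrite mulr_ge0 ?Pr_ge0.
have E0 : 0 <= E (fun psi => inc la lb psi).
  by apply: Ex_pmap_ge0 => psi; apply: increment_ge0.
pose W x y := three_paths (cellw (P i) (va phi) la) (cellw (P j) (vb phi) lb) g x y.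
(* If the samples hit the cell at x' and y', the functions x -> g x y' and y -> g x' y are constant
   on refined classes. Their product correlates with g to the amount W x' y', whose square is
   bounded by [increment_ge]. *)
have step1 : hit * \sum_x \sum_y cellw (P i) (va phi) la x *
    cellw (P j) (vb phi) lb y * W x y ^+ 2 <= M * E (fun psi => M * inc la lb psi).
  apply: Ex_hit_ge => // [psi|x y|psi w w' _ _].
  - by rewrite mulr_ge0 ?increment_ge0.
  - exact: sqr_ge0.
  apply: increment_ge => [x x'|y y'|x x'|y y'|x|y].
  - by case/reg_vcol_join.
  - by case/reg_vcol_join.
  - by case/reg_vcol_join => _ e; rewrite /g /dev e.
  - case/reg_vcol_join => _ e; rewrite /g /dev !(@ecolC _ _ _ _ G i j) // e //.
    by rewrite eq_sym.
  - exact: dev_le1.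
  - exact: dev_le1.
have step2 : C ^+ 2 <= M * _ :=
  sum_three_paths_ge (P i) (P j) f (va phi) (vb phi) la lb.
rewrite Ex_pmapZ in step1.
move: badc; rewrite /bad -/M -/g -/C => badc.
move: step1 step2; rewrite -/g -/W; set X := \sum_x _; set e := E _.
rewrite -/e in E0 *; move=> step1 step2.
have [->|Mn] := eqVneq M 0; first by rewrite !mulr0.
have Mp : 0 < M by rewrite lt_neqAle eq_sym Mn.
have C2 : (theta * M ^+ 2) ^+ 2 <= C ^+ 2.
  rewrite lerXn2r ?nnegrE ?(ltW badc) //; first by rewrite mulr_ge0 ?sqr_ge0 ?ltW.
  by apply: le_trans (ltW badc); rewrite mulr_ge0 ?sqr_ge0 ?ltW.
(* The bounds chain to hit theta^2 M^4 <= hit C^2 <= hit M X <= M^3 e. *)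
rewrite -(@ler_pM2l _ (M ^+ 3)) ?exprn_gt0 //.
have -> : M ^+ 3 * (hit * (theta ^+ 2 * M)) = hit * (theta * M ^+ 2) ^+ 2 by ring.
have -> : M ^+ 3 * e = M * (M * (M * e)) by ring.
apply: le_trans (ler_wpM2l hit0 (le_trans C2 step2)) _.
by rewrite mulrCA ler_pM2l.
Qed.

Variables (kappa : R) (Ma Mb : nat).
Hypothesis kappa01 : 0 <= kappa <= 1.
Hypothesis kappaK : (1 - kappa) ^+ K <= 4^-1.
Hypothesis cardA : (#|reg_vcols G phi i| <= Ma)%N.
Hypothesis cardB : (#|reg_vcols G phi j| <= Mb)%N.

(** Bad cells with both class masses at least kappa are paid for by the energy gain. The other bad
    cells are bounded by their mass, using that the classes lighter than kappa are few. *)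
Lemma graph_bad_mass_le :
  theta ^+ 2 * graph_bad_mass theta phi <=
  2 * (E (fun psi => graph_energy (pmap_join phi psi)) - graph_energy phi) +
  theta ^+ 2 * (kappa * (Ma%:R + Mb%:R)).
Proof.
have /andP[k0 k1] := kappa01.
have th2 : 0 <= theta ^+ 2 := sqr_ge0 _.
have -> : E (fun psi => graph_energy (pmap_join phi psi)) - graph_energy phi =
    \sum_la \sum_lb E (fun psi => inc la lb psi).
  under eq_bigr do rewrite -Ex_pmap_sum.
  rewrite -Ex_pmap_sum -[X in _ - X](Ex_pmap_cst P K) -Ex_pmapB; apply: eq_Ex => psi.
  by apply: energy_increment => x x' /reg_vcol_join [].
have small : \sum_la \sum_lb ma la * mb lb *
    ((ma la < kappa)%R%:R + (mb lb < kappa)%R%:R) <= kappa * (Ma%:R + Mb%:R).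
  have -> : \sum_la \sum_lb ma la * mb lb *
      ((ma la < kappa)%R%:R + (mb lb < kappa)%R%:R) =
      (\sum_la ma la * (ma la < kappa)%R%:R) * (\sum_lb mb lb) +
      (\sum_la ma la) * (\sum_lb mb lb * (mb lb < kappa)%R%:R).
    rewrite !big_distrlr -big_split; apply: eq_bigr => la _ /=.
    by rewrite -big_split; apply: eq_bigr => lb _ /=; ring.
  rewrite !sum_Pr_class mulr1 mul1r mulrDr; apply: lerD.
    apply: (le_trans (small_classes (P i) k0 (@reg_vcolP _ _ _ _ G _ phi i))).
    by rewrite mulrC ler_wpM2l // ler_nat.
  apply: (le_trans (small_classes (P j) k0 (@reg_vcolP _ _ _ _ G _ phi j))).
  by rewrite mulrC ler_wpM2l // ler_nat.
apply: le_trans (lerD (lexx _) (ler_wpM2l th2 small)).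
rewrite /graph_bad_mass bad_massE !mulr_sumr -big_split; apply: ler_sum => la _ /=.
rewrite !mulr_sumr -big_split; apply: ler_sum => lb _ /=.
have E0 : 0 <= E (fun psi => inc la lb psi).
  by apply: Ex_pmap_ge0 => psi; apply: increment_ge0.
have M0 : 0 <= theta ^+ 2 * (ma la * mb lb).
  by apply: mulr_ge0 => //; rewrite mulr_ge0 ?Pr_ge0.
have := @Ex_increment_ge la lb; case: (bad _ _ _ _ _ _ _ _) => hitE; last first.
  rewrite !mulr0 mulrA; apply: addr_ge0; apply: mulr_ge0 => //.
  by rewrite addr_ge0 ?ler0n.
rewrite mulr1 (mulrA (theta ^+ 2)).
case: ltP => [_|ka].
  by have := mulr_ge0 M0 (ler0n R (mb lb < kappa)%R); rewrite /=; lra.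
case: ltP => [_|kb].
  by rewrite /=; lra.
have qa : (1 - ma la) ^+ K <= 4^-1.
  by apply: le_trans kappaK; rewrite lerXn2r ?nnegrE ?subr_ge0 ?Pr_le1 // lerB.
have qb : (1 - mb lb) ^+ K <= 4^-1.
  by apply: le_trans kappaK; rewrite lerXn2r ?nnegrE ?subr_ge0 ?Pr_le1 // lerB.
(* Each class is missed with probability at most 1/4; the resulting 1/2 is the source of the factor
   2 in the statement. *)
have hit : 2^-1 <= 1 - (1 - ma la) ^+ K - (1 - mb lb) ^+ K by lra.
have hit0 : 0 <= 1 - (1 - ma la) ^+ K - (1 - mb lb) ^+ K by lra.
have := le_trans (ler_wpM2r M0 hit) (hitE isT hit0).
by rewrite /=; lra.
Qed.

End Step.
End GraphIncrement.

(** * Counting embeddings *)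

Lemma edensE (R : realType) (r : nat) (Omega vK : 'I_r -> finType) (eK : finType)
    (P : forall i, fdist R (Omega i)) (G : cgraph Omega vK eK) i j c ci cj :
  edens P G (i := i) (j := j) c ci cj =
  dens (P i) (P j) (fun x y => ecol G i j x y == c) (vcol G i) (vcol G j) ci cj.
Proof.
rewrite /edens /cPr /dens; congr (_ / _).
  rewrite PrE pair_bigA; apply: eq_bigr => -[x y] _ /=.
  by rewrite /edge_dist /cellw /class /= -!mulnb !natrM; ring.
rewrite PrE -sum_cellw2 pair_bigA; apply: eq_bigr => -[x y] _ /=.
by rewrite /edge_dist /cellw /class /= -!mulnb !natrM; ring.
Qed.

Lemma natr_forall (R : comPzSemiRingType) (T : finType) (B : pred T) :
  [forall x, B x]%:R = \prod_x (B x)%:R :> R.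
Proof.
case: forallP => [Bx|nB]; first by rewrite big1 // => x _; rewrite Bx.
have /forallPn[x /negPf Bx] : ~~ [forall x, B x] by apply/forallP.
by rewrite (bigD1 x) //= Bx mul0r.
Qed.

(** Only the two extreme terms of the expansion are kept. This turns an additive error x^n into a
    shift of every factor by x; for an empty product it would say 2 <= 1. *)
Lemma prodD_ge (R : realFieldType) (I : Type) (s : seq I) (d : I -> R) (x : R) :
  0 <= x -> (forall e, 0 <= d e) -> (0 < size s)%N ->
  \prod_(e <- s) d e + x ^+ size s <= \prod_(e <- s) (d e + x).
Proof.
move=> x0 d0; elim: s => // e [_ _|e' s IH _]; first by rewrite !big_seq1.
rewrite [X in X + _]big_cons [leRHS]big_cons /= exprS.
have /IH {}IH : (0 < size (e' :: s))%N by [].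
apply: le_trans (ler_wpM2l (addr_ge0 (d0 e) x0) IH).
set A := \prod_(_ <- _) _; set B := x ^+ _.
have A0 : 0 <= A by apply: prodr_ge0.
have B0 : 0 <= B by apply: exprn_ge0.
have := mulr_ge0 x0 A0; have := mulr_ge0 (d0 e) B0.
by rewrite mulrDl !mulrDr /=; lra.
Qed.

(** Intermediate value theorem for the polynomial in x that moves all factors together from lo to
    hi. It supplies the numbers t of the counting identity. *)
Lemma prod_segment_surj (R : rcfType) (I : finType) (Q : pred I) (lo hi : I -> R)
    (V y : R) : V * \prod_(e | Q e) lo e <= y <= V * \prod_(e | Q e) hi e ->
  exists2 x, 0 <= x <= 1 & V * \prod_(e | Q e) (lo e + x * (hi e - lo e)) = y.
Proof.
move=> /andP[ylo yhi].
pose p : {poly R} := V *: \prod_(e | Q e) ((lo e)%:P + (hi e - lo e)%:P * 'X) - y%:P.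
have pE x : p.[x] = V * \prod_(e | Q e) (lo e + x * (hi e - lo e)) - y.
  rewrite /p hornerD hornerN hornerZ horner_prod hornerC; congr (_ * _ - _).
  by apply: eq_bigr => e _; rewrite hornerD hornerM !hornerC hornerX [x * _]mulrC.
have [||x x01 /rootP] := @poly_ivt R p 0 1; first exact: ler01.
  rewrite !pE !subr_le0 !subr_ge0.
  under eq_bigr do rewrite mul0r addr0.
  by under [in X in _ && X]eq_bigr do rewrite mul1r addrC subrK; rewrite ylo yhi.
by rewrite pE => /eqP; rewrite subr_eq0 => /eqP e; exists x.
Qed.

Section Counting.
Variables (R : realType) (r : nat) (Omega vK : 'I_r -> finType) (eK : finType).
Variables (P : forall i, fdist R (Omega i)) (h : nat) (G : cgraph Omega vK eK).
Variable S : scomplex vK eK h.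

Notation E := (Ex (pmap_dist P (m := h))).
Let edge := (('I_r * 'I_r) * ('I_h * 'I_h))%type.

Definition vert_ind i (a : 'I_h) (x : Omega i) : R :=
  if vcol S i a is Some c then (class (vcol G i) c x)%:R else 1.

Definition verts_ind (phi : pmap Omega h) : R :=
  \prod_i \prod_a vert_ind a (phi i a).

Definition verts_dens : R :=
  \prod_(i < r) \prod_(a < h) (if vcol S i a is Some c then vdens P G c else 1).

Definition edge_ind (e : edge) (phi : pmap Omega h) : R :=
  (ecol S e.1.1 e.1.2 e.2.1 e.2.2 ==
   Some (ecol G e.1.1 e.1.2 (phi e.1.1 e.2.1) (phi e.1.2 e.2.2)))%:R.

Lemma vert_ind_ge0 i (a : 'I_h) (x : Omega i) : 0 <= vert_ind a x.
Proof. by rewrite /vert_ind; case: (vcol S i a) => [c|]; rewrite ?ler0n ?ler01. Qed.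

Lemma verts_ind_ge0 phi : 0 <= verts_ind phi.
Proof. by do 2 apply: prodr_ge0 => ? _; apply: vert_ind_ge0. Qed.

Lemma edge_ind_ge0 e phi : 0 <= edge_ind e phi. Proof. exact: ler0n. Qed.

Lemma edge_ind_le1 e phi : edge_ind e phi <= 1.
Proof. by rewrite lern1 leq_b1. Qed.

Lemma verts_dens_ge0 : 0 <= verts_dens.
Proof.
do 2 apply: prodr_ge0 => ? _; case: (vcol S _ _) => [c|]; last exact: ler01.
exact: Pr_ge0.
Qed.

Lemma Ex_verts_ind : E verts_ind = verts_dens.
Proof.
rewrite (Ex_pmap_prod P (fun i a x => vert_ind a x)).
apply: eq_bigr => i _; apply: eq_bigr => a _; rewrite /vert_ind.
case: (vcol S i a) => [c|]; first by rewrite /vdens PrE.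
by under eq_bigr do rewrite mulr1; rewrite pmf_sum1.
Qed.

Lemma embedsE phi : (embeds G S phi)%:R = verts_ind phi *
  \prod_(e : edge | (e.1.1 < e.1.2)%N && (ecol S e.1.1 e.1.2 e.2.1 e.2.2 != None))
    edge_ind e phi.
Proof.
rewrite /embeds -mulnb natrM; congr (_ * _).
  rewrite natr_forall; apply: eq_bigr => i _.
  rewrite natr_forall; apply: eq_bigr => a _; rewrite /vert_ind.
  by case: (vcol S i a) => [c|] //=; rewrite /class eq_sym.
transitivity (\prod_(i < r) \prod_(j < r) \prod_(a < h) \prod_(b < h)
    (((i < j)%N && (ecol S i j a b != None)) ==>
      (ecol S i j a b == Some (ecol G i j (phi i a) (phi j b))))%:R : R).
  rewrite natr_forall; apply: eq_bigr => i _.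
  rewrite natr_forall; apply: eq_bigr => j _.
  rewrite natr_forall; apply: eq_bigr => a _.
  by rewrite natr_forall.
rewrite pair_bigA /=; under eq_bigr do rewrite pair_bigA /=.
rewrite pair_bigA /= [RHS]big_mkcond /=; apply: eq_bigr => e _.
by case: ifP.
Qed.

Lemma upd_upd (phi : pmap Omega h) i j (a b : 'I_h) (x : Omega i) (y : Omega j) k d :
  (j, b) != (k, d) -> upd (upd phi b y) a x k d = upd phi a x k d.
Proof.
move=> ne; have [[ek ed]|ne'] := eqVneq (i, a) (k, d).
  by case: k / ek ne => _; rewrite -ed !upd_same.
by rewrite !upd_other.
Qed.

Section OneEdge.
Variables (i j : 'I_r) (a b : 'I_h) (c : eK) (ci : vK i) (cj : vK j) (eta : R).
Hypothesis ij : (i < j)%N.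
Hypothesis Sc : ecol S i j a b = Some c.
Hypothesis Sci : vcol S i a = Some ci.
Hypothesis Scj : vcol S j b = Some cj.
Hypothesis eta0 : 0 <= eta.

Let f x y := ecol G i j x y == c.
Let w x := cellw (P i) (vcol G i) ci x.
Let w' y := cellw (P j) (vcol G j) cj y.
Let g := dev (P i) (P j) f (vcol G i) (vcol G j) ci cj.
Let M := Pr (P i) (class (vcol G i) ci) * Pr (P j) (class (vcol G j) cj).

Hypothesis good : ~~ bad (P i) (P j) f (vcol G i) (vcol G j) (eta ^+ 4) ci cj.

Let ia_jb : (i, a) != (j, b).
Proof. by rewrite xpair_eqE; apply: contraTN ij => /andP[/eqP-> _]; rewrite ltnn. Qed.

Definition other_verts_ind (phi : pmap Omega h) : R :=
  \prod_(z : 'I_r * 'I_h | (z != (i, a)) && (z != (j, b))) vert_ind z.2 (phi z.1 z.2).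

Lemma verts_ind_upd phi x y :
  P i x * (P j y * verts_ind (upd (upd phi b y) a x)) =
  w x * w' y * other_verts_ind phi.
Proof.
rewrite /verts_ind pair_bigA /= (bigD1 (i, a)) //= (bigD1 (j, b)) /=; last first.
  by rewrite eq_sym.
rewrite upd_same upd_other // upd_same {1 2}/vert_ind Sci Scj.
have -> : \prod_(z | (z != (i, a)) && (z != (j, b)))
    vert_ind z.2 (upd (upd phi b y) a x z.1 z.2) = other_verts_ind phi.
  apply: eq_bigr => -[k d] /= /andP[n1 n2].
  by rewrite !upd_other // eq_sym.
by rewrite /w /w' /cellw; ring.
Qed.

Lemma other_verts_ind_ge0 phi : 0 <= other_verts_ind phi.
Proof. by apply: prodr_ge0 => z _; apply: vert_ind_ge0. Qed.

(** Both ends of the edge are resampled; the vertex indicators there turn P into the cell measures w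
    and w'. *)
Lemma Ex_resample2 (F : pmap Omega h -> R) :
  E (fun phi => verts_ind phi * F phi) =
  E (fun phi => other_verts_ind phi *
    \sum_x \sum_y w x * w' y * F (upd (upd phi b y) a x)).
Proof.
rewrite (Ex_resample P i a) (Ex_resample P j b); apply: eq_Ex => phi.
rewrite mulr_sumr; under [RHS]eq_bigr do rewrite mulr_sumr.
rewrite [RHS]exchange_big /=; apply: eq_bigr => y _.
rewrite mulr_sumr; apply: eq_bigr => x _.
transitivity (P i x * (P j y * verts_ind (upd (upd phi b y) a x)) *
   F (upd (upd phi b y) a x)); first by ring.
by rewrite verts_ind_upd; ring.
Qed.

(** Fourth roots in [cut_le_four_cycles]: the masses give M^2, and goodness bounds the 4-cycles by
    eta^4 M^2. *)
Lemma cut_good (u : Omega i -> R) (v : Omega j -> R) :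
  (forall x, 0 <= u x <= 1) -> (forall y, 0 <= v y <= 1) ->
  `|\sum_x \sum_y w x * w' y * (g x y * (u x * v y))| <= eta * M.
Proof.
move=> u01 v01.
have M0 : 0 <= M by rewrite mulr_ge0 ?Pr_ge0.
have eM0 : 0 <= eta * M by rewrite mulr_ge0.
rewrite -(@ler_pXn2r _ 4) ?nnegrE //.
rewrite -normrX ger0_norm; last by rewrite (exprM _ 2 2) sqr_ge0.
apply: le_trans (cut_le_four_cycles g _ _ u01 v01) _.
- by move=> x; apply: cellw_ge0.
- by move=> y; apply: cellw_ge0.
rewrite !sum_cellw -exprMn -/M.
move: good; rewrite /bad -leNgt -/M => C4.
apply: le_trans (ler_wpM2l (sqr_ge0 _) C4) _.
by have -> : (eta * M) ^+ 4 = M ^+ 2 * (eta ^+ 4 * M ^+ 2) by ring.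
Qed.

(* An edge of S other than {(i, a), (j, b)} contains at most one of (i, a) and
   (j, b), so its indicator depends on only one of the two resampled points. *)
Definition touches (e : edge) : bool :=
  ((e.1.1, e.2.1) == (j, b)) || ((e.1.2, e.2.2) == (j, b)).

Lemma Ex_one_edge (s : seq edge) :
  ((i, j), (a, b)) \notin s -> all (fun e : edge => (e.1.1 < e.1.2)%N) s ->
  `|E (fun phi => verts_ind phi * ((edge_ind ((i, j), (a, b)) phi -
       edens P G c ci cj) * \prod_(e <- s) edge_ind e phi))| <= eta * verts_dens.
Proof.
move=> es slt; rewrite Ex_resample2.
apply: le_trans (Ex_pmap_norm _ _) _.
(* Writing [verts_dens] as an expectation and resampling it too allows a comparison for each fixed
   choice of the other vertices. *)
rewrite -Ex_verts_ind -Ex_pmapZ.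
under [leRHS]eq_Ex do rewrite -[verts_ind _]mulr1 mulrCA.
rewrite Ex_resample2; apply: Ex_pmap_le => phi.
rewrite normrM ger0_norm ?other_verts_ind_ge0 // ler_wpM2l ?other_verts_ind_ge0 //.
have -> : \sum_x \sum_y w x * w' y * (eta * 1) = eta * M.
  rewrite /M -sum_cellw2 mulr_sumr; apply: eq_bigr => x _.
  by rewrite mulr_sumr; apply: eq_bigr => y _; rewrite mulr1 mulrC.
(* With the other vertices fixed, the remaining edges split into a function of x and a function of
   y. *)
pose u (x : Omega i) := \prod_(e <- s | ~~ touches e) edge_ind e (upd phi a x).
pose v (y : Omega j) := \prod_(e <- s | touches e) edge_ind e (upd phi b y).
have e01 (Q : pred edge) psi : 0 <= \prod_(e <- s | Q e) edge_ind e psi <= 1.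
  rewrite prodr_ge0 => [|e _]; last exact: edge_ind_ge0.
  by rewrite prodr_ile1 // => e _; rewrite edge_ind_ge0 edge_ind_le1.
apply: le_trans (@cut_good u v (fun x => e01 _ _) (fun y => e01 _ _)).
rewrite le_eqVlt; apply/orP; left; apply/eqP; congr (`| _ |).
apply: eq_bigr => x _; apply: eq_bigr => y _; congr (_ * (_ * _)).
  by rewrite /g /dev edensE /edge_ind /= Sc upd_same upd_other // upd_same eq_sym.
rewrite (bigID touches) /= mulrC; congr (_ * _).
  rewrite /u [LHS]big_seq_cond [RHS]big_seq_cond; apply: eq_bigr => e.
  case/andP=> _; rewrite negb_or => /andP[n1 n2].
  by rewrite /edge_ind !upd_upd // eq_sym.
rewrite /v [LHS]big_seq_cond [RHS]big_seq_cond; apply: eq_bigr => e.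
case/andP=> ein te.
have elt : (e.1.1 < e.1.2)%N by move/allP: slt => /(_ e ein).
have en : e != ((i, j), (a, b)) by apply: contraTneq ein => ->.
(* A touching edge through (i, a) would be either the edge itself, which is not in s, or its
   reversal, against the order of the parts. *)
have n1 : (i, a) != (e.1.1, e.2.1).
  apply/eqP => n1; move: te; rewrite /touches -n1 (negPf ia_jb) /= => /eqP n2.
  case: n1 n2 en; case: (e) => -[i' j'] [a' b'] /= <- <- [<- <-].
  by rewrite eqxx.
have n2 : (i, a) != (e.1.2, e.2.2).
  apply/eqP => n2; move: te; rewrite /touches -n2 (negPf ia_jb) orbF => /eqP[n3 _].
  by case: n2 elt => <- _; rewrite n3 ltnNge ltnW.
by rewrite /edge_ind (upd_other _ _ n1) (upd_other _ _ n2).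
Qed.

End OneEdge.

End Counting.

(** * The counting lemma with good and bad colours *)

Section CountingLemma.
Variables (R : realType) (r : nat) (Omega vK : 'I_r -> finType) (eK : finType).
Variables (P : forall i, fdist R (Omega i)) (h : nat) (G : cgraph Omega vK eK).
Variables (eta d0 : R).
Let edge := (('I_r * 'I_r) * ('I_h * 'I_h))%type.
Hypotheses (eta0 : 0 <= eta) (d0_ge0 : 0 <= d0) (d0_le1 : d0 <= 1).
Hypothesis eta_d0 : #|{: edge}|%:R * eta <= d0 ^+ #|{: edge}|.

Notation E := (Ex (pmap_dist P (m := h))).

Definition bad_color i j c ci cj : bool :=
  bad (P i) (P j) (fun x y => ecol G i j x y == c) (vcol G i) (vcol G j)
    (eta ^+ 4) ci cj.

Definition delta i j c ci cj : R :=
  if bad_color (i := i) (j := j) c ci cj then 1 else d0.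

Section Complex.
Variable S : scomplex vK eK h.

Definition visible (e : edge) : bool :=
  (e.1.1 < e.1.2)%N && (ecol S e.1.1 e.1.2 e.2.1 e.2.2 != None).

(** An edge that is invisible or has an invisible end gets density 0 and is not [edge_good], so its
    range from [edge_lo] to [edge_hi] is [0, 1]. *)
Definition edge_dens (e : edge) : R :=
  match ecol S e.1.1 e.1.2 e.2.1 e.2.2, vcol S e.1.1 e.2.1, vcol S e.1.2 e.2.2 with
  | Some c, Some ci, Some cj => edens P G c ci cj
  | _, _, _ => 0 end.

Definition edge_good (e : edge) : bool :=
  match ecol S e.1.1 e.1.2 e.2.1 e.2.2, vcol S e.1.1 e.2.1, vcol S e.1.2 e.2.2 with
  | Some c, Some ci, Some cj => ~~ bad_color c ci cj
  | _, _, _ => false end.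

Lemma edge_dens_ge0 e : 0 <= edge_dens e.
Proof.
rewrite /edge_dens; case: (ecol _ _ _ _ _) => // c.
by case: (vcol _ _ _) => // ci; case: (vcol _ _ _) => // cj; rewrite edensE dens_ge0.
Qed.

Lemma edge_dens_le1 e : edge_dens e <= 1.
Proof.
rewrite /edge_dens; case: (ecol _ _ _ _ _) => // c.
by case: (vcol _ _ _) => // ci; case: (vcol _ _ _) => // cj; rewrite edensE dens_le1.
Qed.

Lemma visible_lt e : visible e -> (e.1.1 < e.1.2)%N. Proof. by case/andP. Qed.

(** Induction on s: [Ex_one_edge] replaces the head indicator by its density, and this density, at
    most 1, does not enlarge the error of the tail. *)
Lemma counting (s : seq edge) : uniq s -> all visible s -> all edge_good s ->
  `|E (fun phi => verts_ind R G S phi * \prod_(e <- s) edge_ind R G S e phi) -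
    verts_dens P G S * \prod_(e <- s) edge_dens e| <=
  (size s)%:R * eta * verts_dens P G S.
Proof.
set V := verts_dens P G S; have V0 : 0 <= V := verts_dens_ge0 P G S.
elim: s => [_ _ _|e s IH].
  rewrite big_nil mulr1 mul0r mul0r.
  have -> : E (fun phi => verts_ind R G S phi *
      \prod_(e <- [::]) edge_ind R G S e phi) = V.
    by rewrite /V -Ex_verts_ind; apply: eq_Ex => phi; rewrite big_nil mulr1.
  by rewrite subrr normr0.
move=> /= /andP[es us] /andP[ve vs] /andP[ge gs].
have {IH us gs} := IH us vs gs.
set A := E _; set D := \prod_(_ <- _) _ => IH.
pose B := E (fun phi => verts_ind R G S phi * ((edge_ind R G S e phi - edge_dens e) *
  \prod_(e' <- s) edge_ind R G S e' phi)).
have -> : E (fun phi => verts_ind R G S phi *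
    \prod_(e' <- e :: s) edge_ind R G S e' phi) = B + edge_dens e * A.
  rewrite -Ex_pmapZ -Ex_pmapD; apply: eq_Ex => phi; rewrite big_cons; ring.
rewrite big_cons -/D.
have -> : B + edge_dens e * A - V * (edge_dens e * D) =
  B + edge_dens e * (A - V * D) by ring.
have B1 : `|B| <= eta * V.
  rewrite /B; move: es ve ge; case: (e) => -[i j] [a b] es /andP[/= ij Sc].
  have slt : all (fun e : edge => (e.1.1 < e.1.2)%N) s.
    by apply: sub_all vs => e' /visible_lt.
  rewrite /edge_good /edge_dens /=; case Sc' : (ecol S i j a b) => [c|//].
  case Sci : (vcol S i a) => [ci|//]; case Scj : (vcol S j b) => [cj|//] good.
  exact: (Ex_one_edge ij Sc' Sci Scj eta0 good es slt).
apply: le_trans (ler_normD _ _) _; rewrite -natr1 mulrDl mul1r mulrDl addrC.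
apply: lerD => //; rewrite normrM ger0_norm ?edge_dens_ge0 //.
by apply: le_trans IH; rewrite ler_piMl // edge_dens_le1.
Qed.

Definition edge_lo (e : edge) : R :=
  Num.max 0 (edge_dens e - if edge_good e then d0 else 1).
Definition edge_hi (e : edge) : R :=
  Num.min 1 (edge_dens e + if edge_good e then d0 else 1).

Lemma edge_lo_le_hi e : edge_lo e <= edge_hi e.
Proof.
rewrite /edge_lo /edge_hi ge_max !le_min; have := edge_dens_ge0 e.
have := edge_dens_le1 e; have := d0_ge0.
by case: (edge_good e) => *; apply/andP; split; apply/andP; split; lra.
Qed.

Lemma eta_size (s : seq edge) : uniq s -> (0 < size s)%N ->
  (size s)%:R * eta <= d0 ^+ size s.
Proof.
move=> us s0; have sN : (size s <= #|{: edge}|)%N.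
  by rewrite -(card_uniqP us) max_card.
apply: le_trans (ler_wiXn2l d0_ge0 d0_le1 sN); apply: le_trans eta_d0.
by rewrite ler_wpM2r // ler_nat.
Qed.

Lemma Pr_embedsE : Pr (pmap_dist P (m := h)) (embeds G S) =
  E (fun phi => verts_ind R G S phi * \prod_(e | visible e) edge_ind R G S e phi).
Proof. by rewrite PrE; apply: eq_bigr => phi _; rewrite embedsE. Qed.

Lemma Pr_embeds_le : Pr (pmap_dist P (m := h)) (embeds G S) <=
  verts_dens P G S * \prod_(e | visible e) edge_hi e.
Proof.
have V0 : 0 <= verts_dens P G S := verts_dens_ge0 P G S.
(* Visible edges outside Q have [edge_hi] equal to 1 and their indicators are dropped; the others
   have upper end [edge_dens e + d0]. *)
pose Q e := edge_good e && (edge_dens e + d0 <= 1).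
pose s := [seq e <- index_enum edge | visible e && Q e].
have us : uniq s by rewrite filter_uniq // index_enum_uniq.
have vs : all visible s.
  by apply/allP => e; rewrite mem_filter => /andP[/andP[]].
have gs : all edge_good s.
  by apply/allP => e; rewrite mem_filter => /andP[/andP[_ /andP[]]].
have -> : \prod_(e | visible e) edge_hi e = \prod_(e <- s) (edge_dens e + d0).
  rewrite (bigID Q) /= [X in _ * X]big1 ?mulr1 => [|e /andP[_]].
    rewrite big_filter; apply: eq_bigr => e /andP[_ /andP[ge le1]].
    by rewrite /edge_hi ge; apply/min_idPr.
  rewrite negb_and /edge_hi; case: (edge_good e) => /= [|_].
    by rewrite -ltNge => /ltW /min_idPl.
  by apply/min_idPl; rewrite lerDr edge_dens_ge0.
rewrite Pr_embedsE.
apply: (@le_trans _ _ (E (fun phi => verts_ind R G S phi *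
    \prod_(e <- s) edge_ind R G S e phi))).
  apply: Ex_pmap_le => phi; rewrite ler_wpM2l ?verts_ind_ge0 //.
  rewrite (bigID Q) /= big_filter ler_piMr //.
    by apply: prodr_ge0 => e _; apply: edge_ind_ge0.
  by apply: prodr_ile1 => e _; rewrite edge_ind_ge0 edge_ind_le1.
(* For empty s the count is exact. Otherwise the error is at most d0^n times the vertex densities, n
   being the size of s, and [prodD_ge] absorbs it. *)
have := counting us vs gs; have [s0|s0] := posnP (size s).
  by rewrite (size0nil s0) /= !mul0r !big_nil normr_le0 subr_eq0 => /eqP ->.
rewrite ler_norml => /andP[_]; rewrite lerBlDr => H; apply: le_trans H _.
rewrite mulrC -mulrDr ler_wpM2l // addrC.
apply: le_trans (prodD_ge d0_ge0 edge_dens_ge0 s0).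
by rewrite lerD2l eta_size.
Qed.

Lemma Pr_embeds_ge :
  verts_dens P G S * \prod_(e | visible e) edge_lo e <=
  Pr (pmap_dist P (m := h)) (embeds G S).
Proof.
have V0 : 0 <= verts_dens P G S := verts_dens_ge0 P G S.
(* A zero lower end makes the claim trivial; otherwise every visible edge is good and has density
   above d0. *)
case: (boolP [exists e, visible e && (edge_lo e == 0)]).
  case/existsP => e /andP[ve /eqP lo0].
  rewrite (bigD1 e) //= lo0 mul0r mulr0.
  by apply: sumr_ge0 => phi _; apply: pmap_dist_ge0.
rewrite negb_exists => /forallP lo0.
have good e : visible e -> edge_good e /\ d0 <= edge_dens e.
  move=> ve; have := lo0 e; rewrite ve /= => lo_n0.
  have : 0 < edge_dens e - (if edge_good e then d0 else 1).
    by rewrite ltNge; apply: contra lo_n0 => le; apply/eqP/max_idPl.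
  have := edge_dens_le1 e; case: (edge_good e) => d1 pos; last by lra.
  by split=> //; lra.
pose s := [seq e <- index_enum edge | visible e].
have us : uniq s by rewrite filter_uniq // index_enum_uniq.
have vs : all visible s by apply: filter_all.
have gs : all edge_good s.
  by apply: sub_all vs => e /good [].
have := counting us vs gs; rewrite Pr_embedsE.
have -> : E (fun phi => verts_ind R G S phi *
      \prod_(e | visible e) edge_ind R G S e phi) =
    E (fun phi => verts_ind R G S phi * \prod_(e <- s) edge_ind R G S e phi).
  by apply: eq_Ex => phi; rewrite big_filter.
have -> : \prod_(e | visible e) edge_lo e =
    \prod_(e <- s) Num.max 0 (edge_dens e - d0).
  by rewrite big_filter; apply: eq_bigr => e /good[ge _]; rewrite /edge_lo ge.
have [s0|s0] := posnP (size s).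
  by rewrite (size0nil s0) /= !mul0r !big_nil normr_le0 subr_eq0 => /eqP ->.
rewrite ler_norml => /andP[H _]; move: H; rewrite lerBrDr; apply: le_trans.
rewrite addrC [_ * eta * _]mulrC -mulrBr ler_wpM2l // lerBrDr.
apply: le_trans (lerD (lexx _) (eta_size us s0)) _.
have lo_ge0 e : 0 <= Num.max 0 (edge_dens e - d0) by rewrite le_max lexx.
(* The factors are the lower ends, and shifting them by d0 gives back the densities. *)
apply: le_trans (prodD_ge d0_ge0 lo_ge0 s0) _.
rewrite le_eqVlt; apply/orP; left; apply/eqP; rewrite !big_filter.
apply: eq_bigr => e /good[_ le]; rewrite (max_idPr _) ?subr_ge0 //.
by rewrite subrK.
Qed.

Lemma complex_counting : exists t : 'I_r -> 'I_r -> 'I_h -> 'I_h -> R,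
  (forall (i j : 'I_r) (a b : 'I_h) c ci cj, (i < j)%N ->
     ecol S i j a b = Some c -> vcol S i a = Some ci -> vcol S j b = Some cj ->
     dotpm (edens P G c ci cj) (delta c ci cj) (t i j a b)) /\
  Pr (pmap_dist P (m := h)) (embeds G S) =
    (\prod_(i < r) \prod_(a < h) (if vcol S i a is Some c then vdens P G c else 1)) *
    (\prod_(i < r) \prod_(j < r | (i < j)%N)
       \prod_(a < h) \prod_(b < h | ecol S i j a b != None) t i j a b).
Proof.
have bounds : verts_dens P G S * \prod_(e | visible e) edge_lo e <=
    Pr (pmap_dist P (m := h)) (embeds G S) <=
    verts_dens P G S * \prod_(e | visible e) edge_hi e.
  by rewrite Pr_embeds_ge Pr_embeds_le.
have [x /andP[x0 x1] xE] := prod_segment_surj bounds.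
pose t e := edge_lo e + x * (edge_hi e - edge_lo e).
exists (fun i j a b => t ((i, j), (a, b))); split.
  move=> i j a b c ci cj ij Sc Sci Scj.
  have tlo : edge_lo (i, j, (a, b)) <= t (i, j, (a, b)).
    by rewrite lerDl mulr_ge0 // subr_ge0 edge_lo_le_hi.
  have thi : t (i, j, (a, b)) <= edge_hi (i, j, (a, b)).
    by rewrite -lerBrDl ler_piMl // subr_ge0 edge_lo_le_hi.
  move: tlo thi; rewrite /edge_lo /edge_hi /edge_dens /edge_good /= Sc Sci Scj.
  by rewrite /dotpm /delta; case: (bad_color c ci cj) => /= -> ->.
rewrite -xE; congr (_ * _).
rewrite pair_big_dep /=; under [RHS]eq_bigr do rewrite pair_big_dep /=.
by rewrite pair_big_dep /=; apply: eq_big => // -[[i j] [a b]].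
Qed.

End Complex.

(** Pointwise, delta is at most d0 plus the indicator that the pair's own colour is bad on its
    classes, which is one term of the sum over all colours. *)
Lemma Ex_delta_le i j : i != j ->
  Ex (edge_dist P (i := i) (j := j)) (fun e =>
    delta (ecol G i j e.1 e.2) (vcol G i e.1) (vcol G j e.2)) <=
  d0 + \sum_(c in ecols G [set i; j]) bad_mass (P i) (P j)
    (fun x y => ecol G i j x y == c) (vcol G i) (vcol G j) (eta ^+ 4).
Proof.
move=> ij; have -> : d0 = \sum_x \sum_y P i x * P j y * d0.
  under eq_bigr do rewrite -mulr_suml.
  by rewrite -mulr_suml -big_distrlr /= !pmf_sum1 !mul1r.
rewrite /Ex /bad_mass; under [X in _ + X]eq_bigr do rewrite pair_bigA /=.
rewrite [X in _ + X]exchange_big [X in X + _]pair_bigA -big_split /=.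
apply: ler_sum => -[x y] _ /=.
rewrite /edge_dist /= -mulr_sumr -mulrDr ler_wpM2l ?mulr_ge0 ?pmf_ge0 //.
rewrite (bigD1 (ecol G i j x y)) ?ecolP //= /delta /bad_color.
have X0 : 0 <= \sum_(c in ecols G [set i; j] | c != ecol G i j x y)
    (bad (P i) (P j) (fun x y => ecol G i j x y == c) (vcol G i) (vcol G j)
      (eta ^+ 4) (vcol G i x) (vcol G j y))%:R :> R.
  by apply: sumr_ge0 => c _; apply: ler0n.
by case: ifP => _ /=; rewrite ?addrA ?addr0; move: X0 d0_ge0; lra.
Qed.

Lemma regular_of_bad_mass eps :
  (forall i j : 'I_r, (i < j)%N ->
     d0 + \sum_(c in ecols G [set i; j]) bad_mass (P i) (P j)
       (fun x y => ecol G i j x y == c) (vcol G i) (vcol G j) (eta ^+ 4)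
     <= eps / #|ecols G [set i; j]|%:R) ->
  regular P h G eps.
Proof.
move=> H; exists delta; split.
- by move=> i j c ci cj; rewrite /delta; case: ifP => _; rewrite ?ler01.
- by move=> S _; apply: complex_counting.
move=> i j ij; apply: le_trans (H _ _ ij); apply: Ex_delta_le.
by apply: contraTneq ij => ->; rewrite ltnn.
Qed.

End CountingLemma.

(** * Averaging over the sample size *)

Lemma fdist_inhabited (R : realType) (T : finType) (p : fdist R T) : exists x : T, true.
Proof.
case: (pickP (fun _ : T => true)) => [x _|T0]; first by exists x.
have := pmf_sum1 p; rewrite big_pred0 // => /eqP.
by rewrite eq_sym oner_eq0.
Qed.

(** * Bounding the regularity by the mass of bad colours *)

Section RegBound.
Variables (R : realType) (r : nat) (Omega vK : 'I_r -> finType) (eK : finType).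
Variables (P : forall i, fdist R (Omega i)) (h : nat) (G : cgraph Omega vK eK).

Lemma card_ecols_gt0 i j : i != j -> (0 < #|ecols G [set i; j]|)%N.
Proof.
move=> ij; have [x _] := fdist_inhabited (P i); have [y _] := fdist_inhabited (P j).
by apply/card_gt0P; exists (ecol G i j x y); apply: ecolP.
Qed.

Lemma regular_ge0 eps : (2 <= r)%N -> regular P h G eps -> 0 <= eps.
Proof.
move=> r2 [delta [delta0 _ deltaE]].
pose i : 'I_r := Ordinal (ltnW r2); pose j : 'I_r := Ordinal r2.
have ij : (i < j)%N by [].
have c0 : (0 < #|ecols G [set i; j]|)%N by apply: card_ecols_gt0.
have := deltaE i j ij; rewrite ler_pdivlMr ?ltr0n //; apply: le_trans.
rewrite mulr_ge0 ?ler0n //; apply: sumr_ge0 => e _.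
by rewrite mulr_ge0 // mulr_ge0 ?pmf_ge0.
Qed.

Variables (b2 : nat) (eta d0 : R).
Let edge := (('I_r * 'I_r) * ('I_h * 'I_h))%type.
Hypotheses (eta0 : 0 <= eta) (d0_ge0 : 0 <= d0) (d0_le1 : d0 <= 1).
Hypothesis eta_d0 : #|{: edge}|%:R * eta <= d0 ^+ #|{: edge}|.
Hypothesis cb2 : forall I : {set 'I_r}, #|I| = 2 -> (#|ecols G I| <= b2)%N.

Lemma bad_mass_ge0 (T U KA KB : finType) (p : fdist R T) (q : fdist R U) f
    (a : T -> KA) (b : U -> KB) theta : 0 <= bad_mass p q f a b theta.
Proof. by do 2 apply: sumr_ge0 => ? _; rewrite !mulr_ge0 ?pmf_ge0 ?ler0n. Qed.

(** Summing over all pairs of parts gives one eps that serves each pair; the factor b2 pays for the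
    division by the number of colours. *)
Lemma reg_le : (2 <= r)%N -> reg P h G <=
  b2%:R * (d0 + \sum_(i < r) \sum_(j < r | (i < j)%N)
  \sum_(c in ecols G [set i; j]) bad_mass (P i) (P j)
       (fun x y => ecol G i j x y == c) (vcol G i) (vcol G j) (eta ^+ 4)).
Proof.
move=> r2; apply: ge_inf; first by exists 0 => eps; apply: regular_ge0.
apply: (regular_of_bad_mass eta0 d0_ge0 d0_le1 eta_d0) => i j ij.
have ij' : i != j by apply: contraTneq ij => ->; rewrite ltnn.
have c0 := card_ecols_gt0 ij'; rewrite ler_pdivlMr ?ltr0n // mulrC.
apply: ler_pM.
- exact: ler0n.
- by rewrite addr_ge0 // sumr_ge0 // => c _; apply: bad_mass_ge0.
- by rewrite ler_nat cb2 // cards2 ij'.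
rewrite lerD2l (bigD1 i) //= (bigD1 j) //= -addrA lerDl addr_ge0 //.
  by do 2 apply: sumr_ge0 => ? _; apply: bad_mass_ge0.
by do 3 apply: sumr_ge0 => ? _; apply: bad_mass_ge0.
Qed.

End RegBound.

(** At most r m vertices are seen, each through at most b2 colours. The base [b2.+1] keeps the power
    monotone in the exponent when b2 = 0. *)
Lemma card_reg_vcols (r : nat) (Omega vK : 'I_r -> finType) (eK : finType)
    (G : cgraph Omega vK eK) b1 b2 m (phi : pmap Omega m) i :
  colored_by b1 b2 G -> (#|reg_vcols G phi i| <= b1 * b2.+1 ^ (r * m))%N.
Proof.
case=> cb1 cb2; rewrite cardsX; apply: leq_mul; first exact: cb1.
pose F (u : {u | seen phi i u}) := mem (ecols G [set i; tag (val u)]).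
have -> : #|[set f : {ffun {u | seen phi i u} -> eK} |
    [forall u, f u \in ecols G [set i; tag (val u)]]]| = #|family F|.
  rewrite cardsE; apply: eq_card => f; rewrite !inE.
  by apply/forallP/familyP => H u; have := H u.
rewrite card_family.
apply: (@leq_trans (b2.+1 ^ #|{: {u | seen phi i u}}|)).
  rewrite cardE /image_mem; elim: (enum _) => //= u s IH; rewrite expnS leq_mul //.
  apply: leqW; apply: cb2; rewrite cards2 eq_sym.
  by have /andP[-> _] := valP u.
apply: leq_pexp2l => //; rewrite card_sig.
pose g (z : 'I_r * 'I_m) : {j : 'I_r & Omega j} :=
  existT (fun j => Omega j : Type) z.1 (phi z.1 z.2).
apply: (@leq_trans #|codom g|).
  apply/subset_leq_card/fintype.subsetP => -[j y].
  rewrite inE => /andP[/= _ /codomP[w ->]].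
  exact: (codom_f g (j, w)).
by apply: leq_trans (leq_image_card _ _) _; rewrite card_prod !card_ord.
Qed.

(** By Bernoulli, (1 - kappa)^n (1 + n kappa) <= 1, so any n with n kappa >= 3 serves as the
    exponent. *)
Lemma geometric_small (R : realType) (kappa : R) : 0 < kappa <= 1 ->
  exists K, (1 - kappa) ^+ K.+1 <= 4^-1.
Proof.
case/andP=> k0 k1.
have bernoulli K : (1 - kappa) ^+ K * (1 + K%:R * kappa) <= 1.
  elim: K => [|K IH]; first by rewrite expr0 mul0r addr0 mulr1.
  apply: le_trans IH; rewrite exprSr -mulrA ler_wpM2l ?exprn_ge0 ?subr_ge0 //.
  have := mulr_ge0 (ler0n R K) (sqr_ge0 kappa); have := sqr_ge0 kappa.
  by rewrite -natr1 !expr2; lra.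
exists (Num.bound (3 / kappa)); set K := (Num.bound _).+1.
have K3 : 3 <= K%:R * kappa.
  rewrite -ler_pdivrMr // /K -[leRHS]natr1 ler_wpDr //.
  by apply: ltW; apply: archi_boundP; rewrite divr_ge0 ?ltW.
have q0 : 0 <= (1 - kappa) ^+ K by rewrite exprn_ge0 ?subr_ge0.
have := bernoulli K; have := ler_wpM2l q0 K3; lra.
Qed.

(** From size m, [(K m).+1] fresh samples are added, so the sizes increase strictly even where K
    vanishes. *)
Fixpoint sample_size (K : nat -> nat) (n : nat) : nat :=
  if n is n'.+1 then (sample_size K n' + (K (sample_size K n')).+1)%N else 0%N.

Lemma sample_size_lt K : {homo sample_size K : x y / (x < y)%N}.
Proof.
by apply: homo_ltn => [a b c|n]; [apply: ltn_trans|rewrite /= addnS ltnS leq_addr].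
Qed.

Section Average.
Variables (R : realType) (r : nat) (Omega vK : 'I_r -> finType) (eK : finType).
Variables (P : forall i, fdist R (Omega i)) (G : cgraph Omega vK eK).
Variables (b1 b2 : nat) (theta xi : R) (K : nat -> nat).
(** Twice a bound for the number of vertex colours of G/phi in one part: with kappa = xi / M m, the
    tiny classes of two parts cost at most xi. The successors keep M m positive. *)
Let M m : R := (2 * (b1.+1 * b2.+1 ^ (r * m)))%:R.
Hypothesis colG : colored_by b1 b2 G.
Hypothesis theta0 : 0 < theta.
Hypothesis xi01 : 0 < xi <= 1.
Hypothesis KE : forall m, (1 - xi / M m) ^+ (K m).+1 <= 4^-1.

(** The energy gains telescope to at most 1, so theta^2 times the sum over n is at most 2 + theta^2
    xi N, and N is so large that 2 <= theta^2 xi N. *)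
Lemma average_bad_mass (i j : 'I_r) c N : i != j -> (0 < N)%N ->
  2 / (theta ^+ 2 * xi) <= N%:R ->
  N%:R^-1 * \sum_(n < N) Ex (pmap_dist P (m := sample_size K n))
    (fun phi => graph_bad_mass P G i j c theta phi) <= 2 * xi.
Proof.
move=> ij N0 Nbig; have /andP[xi0 xi1] := xi01.
have th2 : 0 < theta ^+ 2 by rewrite exprn_gt0.
pose Q n := Ex (pmap_dist P (m := sample_size K n))
  (fun phi => graph_energy P G i j c phi).
have step n : theta ^+ 2 * Ex (pmap_dist P (m := sample_size K n))
    (fun phi => graph_bad_mass P G i j c theta phi) <=
    2 * (Q n.+1 - Q n) + theta ^+ 2 * xi.
  set m := sample_size K n.
  have -> : Q n.+1 = Ex (pmap_dist P (m := m)) (fun phi =>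
      Ex (pmap_dist P (m := (K m).+1)) (fun psi =>
        graph_energy P G i j c (pmap_join phi psi))).
    by rewrite -(Ex_pmap_join P (fun phi => graph_energy P G i j c phi)).
  rewrite -[X in _ + X](Ex_pmap_cst P m) -Ex_pmapB -!Ex_pmapZ -Ex_pmapD.
  apply: Ex_pmap_le => phi.
  have M0 : 0 < M m by rewrite ltr0n !muln_gt0 expn_gt0.
  have kappa01 : 0 <= xi / M m <= 1.
    apply/andP; split; first by rewrite divr_ge0 ?ltW.
    rewrite ler_pdivrMr // mul1r (le_trans xi1) //.
    by rewrite ler1n !muln_gt0 expn_gt0.
  have cardV k : (#|reg_vcols G phi k| <= b1.+1 * b2.+1 ^ (r * m))%N.
    apply: leq_trans (card_reg_vcols phi k colG) _.
    by rewrite leq_mul2r leqnSn orbT.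
  have := graph_bad_mass_le P c ij theta0 kappa01 (KE m) (cardV i) (cardV j).
  congr (_ <= _ + _ * _); rewrite -natrD addnn -mul2n -/(M m).
  by rewrite divfK // gt_eqF.
have tel : \sum_(n < N) (2 * (Q n.+1 - Q n) + theta ^+ 2 * xi) =
    2 * (Q N - Q 0%N) + theta ^+ 2 * xi * N%:R.
  rewrite big_split /= -mulr_sumr sumr_const card_ord mulr_natr.
  by rewrite -(big_mkord xpredT (fun n => Q n.+1 - Q n)) telescope_sumr.
have Q0 : 0 <= Q 0%N by apply: Ex_pmap_ge0 => phi; apply: energy_ge0.
have Q1 : Q N <= 1.
  rewrite -(Ex_pmap_cst P (sample_size K N) 1).
  by apply: Ex_pmap_le => phi; apply: energy_le1.
rewrite mulrC ler_pdivrMr ?ltr0n // -(ler_pM2l th2) mulr_sumr.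
apply: le_trans (ler_sum _ (fun (n : 'I_N) _ => step n)) _; rewrite tel.
move: Nbig; rewrite ler_pdivrMr ?mulr_gt0 // => Nbig.
by lra.
Qed.

End Average.

(** * Choice of the constants and conclusion *)

Theorem mainTheorem1 (R : realType) (r h b1 b2 : nat) (eps : R) :
  (2 <= r)%N -> (0 < h)%N -> 0 < eps ->
  exists (m : nat -> nat) (ntilde : nat),
    [/\ {homo m : x y / (x < y)%N},
        (0 < ntilde)%N
      & forall (Omega : 'I_r -> finType) (P : forall i, fdist R (Omega i))
          (vK : 'I_r -> finType) (eK : finType) (G : cgraph Omega vK eK),
          colored_by b1 b2 G ->
          ntilde%:R^-1 *
            \sum_(n < ntilde)
              Ex (pmap_dist P (m := m n))
                 (fun phi => reg P h (regularize G phi))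
          <= eps].
Proof.
move=> r2 h0 eps0.
(* L bounds the number of edges of a complex. The constants ensure b2 d0 <= eps / 2, L eta <= d0^L
   and 2 T xi <= eps / 2, where T bounds the number of terms in [reg_le] times its factor b2. All
   are fixed before Omega and G. *)
pose L := #|{: ('I_r * 'I_r) * ('I_h * 'I_h)}|.
pose d0 : R := Num.min 1 (eps / (2 * b2.+1%:R)).
pose eta : R := d0 ^+ L / L.+1%:R.
pose theta := eta ^+ 4.
pose T := (b2 * (r * (r * b2)))%N.
pose xi : R := Num.min 1 (eps / (4 * T.+1%:R)).
have d0p : 0 < d0 by rewrite lt_min ltr01 divr_gt0 ?mulr_gt0 ?ltr0n.
have d01 : d0 <= 1 by rewrite ge_min lexx.
have d0eps : b2%:R * d0 <= eps / 2.
  have le : d0 <= eps / (2 * b2.+1%:R) by rewrite ge_min lexx orbT.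
  by move: le; rewrite ler_pdivlMr ?mulr_gt0 ?ltr0n // -[b2.+1%:R]natr1; lra.
have eta0 : 0 < eta by rewrite divr_gt0 ?exprn_gt0 ?ltr0n.
have eta_d0 : L%:R * eta <= d0 ^+ L.
  rewrite /eta mulrCA ler_piMr ?exprn_ge0 ?ltW // ltr_pdivrMr ?ltr0n //.
  by rewrite mul1r ltr_nat.
have th0 : 0 < theta by rewrite exprn_gt0.
have xi0 : 0 < xi by rewrite lt_min ltr01 divr_gt0 ?mulr_gt0 ?ltr0n.
have xi01 : 0 < xi <= 1 by rewrite xi0 ge_min lexx.
have xieps : T%:R * (2 * xi) <= eps / 2.
  have le : xi <= eps / (4 * T.+1%:R) by rewrite ge_min lexx orbT.
  by move: le; rewrite ler_pdivlMr ?mulr_gt0 ?ltr0n // -[T.+1%:R]natr1; lra.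
pose M m : R := (2 * (b1.+1 * b2.+1 ^ (r * m)))%:R.
have /choice[K KE] : forall m, exists K, (1 - xi / M m) ^+ K.+1 <= 4^-1.
  move=> m; apply: geometric_small.
  have M1 : 1 <= M m by rewrite ler1n !muln_gt0 expn_gt0.
  have M0 : 0 < M m by apply: lt_le_trans M1.
  rewrite divr_gt0 //= ler_pdivrMr // mul1r; case/andP: xi01 => _ /le_trans; exact.
pose N := (Num.bound (2 / (theta ^+ 2 * xi))).+1.
have Nbig : 2 / (theta ^+ 2 * xi) <= N%:R.
  rewrite /N -[leRHS]natr1 ler_wpDr //; apply/ltW/archi_boundP.
  by rewrite divr_ge0 // mulr_ge0 ?ltW // exprn_gt0.
exists (sample_size K), N; split=> //; first exact: sample_size_lt.
move=> Omega P vK eK G colG.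
have N0 : 0 < N%:R :> R by rewrite ltr0n.
pose B n i j c := Ex (pmap_dist P (m := sample_size K n))
  (fun phi => graph_bad_mass P G i j c theta phi).
have regB n : Ex (pmap_dist P (m := sample_size K n))
    (fun phi => reg P h (regularize G phi)) <=
  b2%:R * (d0 + \sum_(i < r) \sum_(j < r | (i < j)%N)
    \sum_(c in ecols G [set i; j]) B n i j c).
  apply: (@le_trans _ _ (Ex (pmap_dist P (m := sample_size K n)) (fun phi =>
     b2%:R * (d0 + \sum_(i < r) \sum_(j < r | (i < j)%N)
    \sum_(c in ecols G [set i; j]) graph_bad_mass P G i j c theta phi)))).
    apply: Ex_pmap_le => phi.
    by apply: (@reg_le _ _ _ _ _ P h (regularize G phi) b2 eta d0) => //;
      [apply: ltW|apply: ltW|case: colG].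
  rewrite Ex_pmapZ Ex_pmapD Ex_pmap_cst Ex_pmap_sum.
  under [X in b2%:R * (d0 + X) <= _]eq_bigr do rewrite Ex_pmap_sum.
  under [X in b2%:R * (d0 + X) <= _]eq_bigr do under eq_bigr do rewrite Ex_pmap_sum.
  exact: lexx.
(* Pair colours of G/phi are those of G, so the sum over c has the same range for all n and the
   average over n passes inside. *)
apply: (@le_trans _ _ (b2%:R * d0 + b2%:R * \sum_(i < r) \sum_(j < r | (i < j)%N)
    \sum_(c in ecols G [set i; j]) (N%:R^-1 * \sum_(n < N) B n i j c))).
  apply: le_trans (ler_wpM2l _ (ler_sum _ (fun (n : 'I_N) _ => regB n))) _.
    by rewrite invr_ge0 ltW.
  rewrite le_eqVlt; apply/orP; left; apply/eqP.
  under eq_bigr do rewrite mulrDr.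
  rewrite big_split /= mulrDr sumr_const card_ord.
  rewrite -[(b2%:R * d0) *+ N]mulr_natl mulKf ?gt_eqF //.
  congr (_ + _); rewrite -mulr_sumr mulrCA; congr (_ * _).
  rewrite exchange_big mulr_sumr; apply: eq_bigr => i _ /=.
  rewrite exchange_big mulr_sumr; apply: eq_bigr => j _ /=.
  by rewrite exchange_big mulr_sumr.
have avg (i j : 'I_r) c : (i < j)%N -> N%:R^-1 * \sum_(n < N) B n i j c <= 2 * xi.
  move=> ij; apply: (average_bad_mass P colG) => //.
  by apply: contraTneq ij => ->; rewrite ltnn.
have xi2 : 0 <= 2 * xi by rewrite mulr_ge0 ?ltW.
have sumB : \sum_(i < r) \sum_(j < r | (i < j)%N)
    \sum_(c in ecols G [set i; j]) (N%:R^-1 * \sum_(n < N) B n i j c) <=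
    (r * (r * b2))%:R * (2 * xi).
  have -> : (r * (r * b2))%:R * (2 * xi) =
      \sum_(i < r) \sum_(j < r) b2%:R * (2 * xi).
    by rewrite !sumr_const card_ord -mulrnA -[RHS]mulr_natl !natrM; ring.
  apply: ler_sum => i _; rewrite big_mkcond.
  apply: ler_sum => j _; case: ifP => ij; last by rewrite mulr_ge0 ?ler0n.
  apply: le_trans (ler_sum _ (fun c _ => avg i j c ij)) _.
  rewrite sumr_const -[(2 * xi) *+ _]mulr_natl ler_wpM2r // ler_nat.
  case: colG => _; apply.
  by rewrite cards2; case: eqP ij => // ->; rewrite ltnn.
have := ler_wpM2l (ler0n R b2) sumB; rewrite [leRHS]mulrA -natrM -/T => bound.
by lra.
Qed.
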